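(* Let $T$ be a stable complete first-order theory in a countable language, and let $\Delta$ be a finite collection of formulas of $T$. Let $\kappa$ be a singular cardinal, and let $d < \omega$. Then whenever $M \models T$, $A \subseteq M$ has size less than $\mathrm{cof}(\kappa)$, and $X \subseteq M^d$ has size $\geq \kappa$, there is some $Y \subseteq X$ of size $\kappa$ and some equivalence relation $E$ on $Y$, such that $E$ has infinitely many classes, each equivalence class is infinite, and $Y$ is $(\Delta, E)$-indiscernible over $A$.
   Context: For a finite tuple $\overline{b}$ from $M$ and $A \subseteq M$, $tp_\Delta(\overline{b}/A)$ is the set of all formulas $\phi(\overline{x}, \overline{a})$ such that $\overline{a}\in A^{<\omega}$, $\phi(\overline{x},\overline{y}) \in \Delta$ and $M \models \phi(\overline{b},\overline{a})$; here the variables of a formula of $\Delta$ may be assigned arbitrarily (with repetitions) to coordinates of $\overline{b}$ or to elements of $A$. A tuple of elements of $M^d$ is regarded as a tuple of elements of $M$ by concatenation. Let $Y \subseteq M^d$ and let $E$ be an equivalence relation on $Y$. $Y$ is $(\Delta,E)$-indiscernible over $A$ if for every $n<\omega$ and all sequences $\overline{a}_0, \ldots, \overline{a}_{n-1}$ and $\overline{b}_0, \ldots, \overline{b}_{n-1}$ of elements of $Y$, with the $\overline{a}_i$ pairwise distinct and the $\overline{b}_i$ pairwise distinct: if for every $i < j < n$ we have $\overline{a}_i \, E\, \overline{a}_j$ if and only if $\overline{b}_i\, E\, \overline{b}_j$, then $tp_\Delta(\overline{a}_0,\ldots,\overline{a}_{n-1}/A) = tp_\Delta(\overline{b}_0,\ldots,\overline{b}_{n-1}/A)$.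 *)

(* Defs.v *)
From mathcomp Require Import all_boot.
From mathcomp Require Import boolp classical_sets cardinality wochoice.

Set Implicit Arguments.
Unset Strict Implicit.
Unset Printing Implicit Defensive.

Local Open Scope classical_set_scope.
Local Open Scope card_scope.

Record language := Language {
  fsym : Type;
  rsym : Type;
  farity : fsym -> nat;
  rarity : rsym -> nat }.

(* Constants are function symbols of arity 0. *)
Definition countable_language (L : language) : Prop :=
  countable [set: fsym L] /\ countable [set: rsym L].

(* Variables are named by natural numbers. *)
Inductive term (L : language) : Type :=
| Var (x : nat)
| App (f : fsym L) (args : 'I_(farity f) -> term L).

Inductive formula (L : language) : Type :=
| Bot
| Equal (s t : term L)
| Atom (r : rsym L) (args : 'I_(rarity r) -> term L)
| Imp (phi psi : formula L)
| All (x : nat) (phi : formula L).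

Definition Neg (L : language) (phi : formula L) : formula L :=
  Imp phi (@Bot L).

Fixpoint term_fv (L : language) (t : term L) : set nat :=
  match t with
  | Var x => [set x]
  | App f args => [set x | exists i, term_fv (args i) x]
  end.

Fixpoint fv (L : language) (phi : formula L) : set nat :=
  match phi with
  | Bot => set0
  | Equal s t => term_fv s `|` term_fv t
  | Atom r args => [set x | exists i, term_fv (args i) x]
  | Imp psi chi => fv psi `|` fv chi
  | All x psi => fv psi `\ x
  end.

Definition sentence (L : language) (phi : formula L) : Prop := fv phi = set0.

Record structure (L : language) := Structure {
  dom :> Type;
  dom_inhabited : inhabited dom;
  finterp : forall f : fsym L, ('I_(farity f) -> dom) -> dom;
  rinterp : forall r : rsym L, ('I_(rarity r) -> dom) -> Prop }.

Fixpoint eval (L : language) (M : structure L) (v : nat -> M) (t : term L) : M :=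
  match t with
  | Var x => v x
  | App f args => finterp (fun i => eval v (args i))
  end.

Definition update (D : Type) (v : nat -> D) (x : nat) (a : D) : nat -> D :=
  fun y => if y == x then a else v y.

Fixpoint sat (L : language) (M : structure L) (v : nat -> M) (phi : formula L)
    : Prop :=
  match phi with
  | Bot => False
  | Equal s t => eval v s = eval v t
  | Atom r args => rinterp (fun i => eval v (args i))
  | Imp psi chi => sat v psi -> sat v chi
  | All x psi => forall a : M, sat (update v x a) psi
  end.

Definition models (L : language) (M : structure L) (T : set (formula L)) : Prop :=
  forall phi, T phi -> forall v : nat -> M, sat v phi.

Definition entails (L : language) (T : set (formula L)) (phi : formula L) : Prop :=
  forall M : structure L, models M T -> forall v : nat -> M, sat v phi.

Definition complete_theory (L : language) (T : set (formula L)) : Prop :=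
  [/\ forall phi, T phi -> sentence phi,
      exists M : structure L, models M T
    & forall phi, sentence phi -> entails T phi \/ entails T (Neg phi)].

(* [p] partitions the variables of [phi] into phi(xbar; ybar): [p x] holds when
   [x] belongs to xbar.  Only finitely many variables are free in [phi], so
   [a i] and [b j] represent finite tuples. *)
Definition order_property (L : language) (T : set (formula L)) (phi : formula L)
    : Prop :=
  exists (M : structure L) (p : pred nat) (a b : nat -> nat -> M),
    models M T /\
    forall i j : nat,
      sat (fun x => if p x then a i x else b j x) phi <-> (i < j)%N.

Definition stable (L : language) (T : set (formula L)) : Prop :=
  forall phi : formula L, ~ order_property T phi.

Definition card_lt (T U : Type) (A : set T) (B : set U) : Prop :=
  A #<= B /\ ~ (B #<= A).

(* A cardinal is an initial ordinal: a well-ordered type all of whose proper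
   initial segments have smaller cardinality. *)
Definition is_cardinal (K : Type) (le : rel K) : Prop :=
  well_order le /\
  forall x : K, card_lt [set y | le y x /\ y <> x] [set: K].

Definition cofinal (K : Type) (le : rel K) (C : set K) : Prop :=
  forall x : K, exists2 y, C y & le x y.

(* The size of [C] is the cofinality of [(K, le)]. *)
Definition attains_cof (K : Type) (le : rel K) (C : set K) : Prop :=
  cofinal le C /\ forall C' : set K, cofinal le C' -> C #<= C'.

Definition singular_cardinal (K : Type) (le : rel K) : Prop :=
  [/\ is_cardinal le, infinite_set [set: K]
    & exists2 C : set K, attains_cof le C & card_lt C [set: K]].

Definition lt_cof (U : Type) (A : set U) (K : Type) (le : rel K) : Prop :=
  forall C : set K, attains_cof le C -> card_lt A C.

(* The pair [(phi, s)] stands for the formula obtained from [phi] by replacing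
   each free variable [x] by the coordinate [i] of the tuple if [s x = inl i],
   and by the parameter [c] if [s x = inr c]. *)
Definition tp (L : language) (M : structure L) (Delta : set (formula L))
    (A : set M) (I : finType) (b : I -> M)
    : set (formula L * (nat -> I + M)) :=
  [set q | [/\ Delta q.1,
               forall x c, fv q.1 x -> q.2 x = inr c -> A c
             & sat (fun x => match q.2 x with inl i => b i | inr c => c end)
                 q.1]].

(* The coordinates of the concatenation of n d-tuples are indexed by pairs. *)
Definition concat (D : Type) (n d : nat) (a : 'I_n -> d.-tuple D)
    : 'I_n * 'I_d -> D :=
  fun k => tnth (a k.1) k.2.

Definition equivalence_on (U : Type) (Y : set U) (E : U -> U -> Prop) : Prop :=
  [/\ forall x, Y x -> E x x,
      forall x y, Y x -> Y y -> E x y -> E y x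
    & forall x y z, Y x -> Y y -> Y z -> E x y -> E y z -> E x z].

Definition eclass (U : Type) (Y : set U) (E : U -> U -> Prop) (x : U) : set U :=
  [set y | Y y /\ E x y].

Definition eclasses (U : Type) (Y : set U) (E : U -> U -> Prop) : set (set U) :=
  [set eclass Y E x | x in Y].

Definition indiscernible (L : language) (M : structure L)
    (Delta : set (formula L)) (d : nat) (Y : set (d.-tuple M))
    (E : d.-tuple M -> d.-tuple M -> Prop) (A : set M) : Prop :=
  forall (n : nat) (a b : 'I_n -> d.-tuple M),
    (forall i, Y (a i)) -> (forall i, Y (b i)) ->
    injective a -> injective b ->
    (forall i j : 'I_n, (i < j)%N -> (E (a i) (a j) <-> E (b i) (b j))) ->
    tp Delta A (concat a) = tp Delta A (concat b).

(* Main.v *)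
Require Import Defs.
From mathcomp Require Import all_boot.
From mathcomp Require Import boolp classical_sets functions cardinality.
From mathcomp Require Import filter wochoice.

Set Implicit Arguments.
Unset Strict Implicit.
Unset Printing Implicit Defensive.

Local Open Scope classical_set_scope.
Local Open Scope card_scope.

(** Fix an ideal of small sets.  By stability, every nonsmall set [Z] of tuples
    has a nonsmall subset on which each instance of a given formula holds either
    almost everywhere or almost nowhere: otherwise nonsmall sets could be split
    forever, which produces long half graphs.  On such sets one can form the
    relation "for almost all [x] in [Z], [T(x, ...)]"; it is again stable (the
    same bound on half graphs works), and two such quantifiers commute.  Hence
    the truth value of a formula on a tuple of independently generic elements is
    computed by quantifying all its variables generically, in any order.

    Let [C] be cofinal in [kappa] of size [cof kappa].  For each index [k] in [C]
    take a set [Z_k] as above in [X], where small means of size at most [|k|].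
    Quantifying formulas generically over the [Z_k] yields stable relations
    between indices; applying the same method to these, with noncofinal sets of
    indices as the ideal, gives a cofinal set of indices on which the relations
    depend only on the equality pattern of the indices.  The set [Y] consists of
    [|k|] generic elements of [Z_k] for each such index [k], and the classes of
    [E] are given by the index.

    Bounds on the length of half graphs in [M] come from the absence of infinite
    half graphs in an ultrapower of [M]. *)

(** * Cardinal arithmetic *)

Lemma card_le_of_inj (T U : Type) (A : set T) (B : set U) (f : T -> U) :
  (forall x, A x -> B (f x)) ->
  (forall x y, A x -> A y -> f x = f y -> x = y) -> A #<= B.
Proof.
move=> fAB finj.
have /card_eqPle[_ le1] : f @` A #= A.
  by apply: inj_card_eq => x y /set_mem Ax /set_mem Ay; apply: finj.
apply: card_le_trans le1 _; apply: subset_card_le => _ [x Ax <-]; exact: fAB.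
Qed.

Lemma inj_of_card_le (T U : Type) (A : set T) (B : set U) : A #<= B ->
  B !=set0 ->
  exists2 f : T -> U, forall x, A x -> B (f x)
    & forall x y, A x -> A y -> f x = f y -> x = y.
Proof.
move=> /card_leP[f] [u Bu].
pose F := fun x : T => if pselect (A x) is left Ax
                  then set_val (f (SigSub (mem_set Ax))) else u.
exists F => [x|x y] Ax; first by rewrite /F; case: pselect => // Ax'; exact: set_valP.
move=> Ay; rewrite /F; case: pselect => // Ax'; case: pselect => // Ay'.
move=> /val_inj /(@inj _ _ _ f); rewrite !inE => /(_ I I) [] //.
Qed.

Lemma surj_of_card_le (T U : Type) (A : set T) (B : set U) : A #<= B ->
  A !=set0 ->
  exists2 g : U -> T, forall y, B y -> A (g y)
    & forall x, A x -> exists2 y, B y & g y = x.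
Proof.
move=> AB [a Aa].
have [B0|/set0P Bn0] := eqVneq B set0.
  by move: AB; rewrite B0 => /card_le0P A0; move: Aa; rewrite A0.
have [f fAB finj] := inj_of_card_le AB Bn0.
pose g y := if pselect (exists2 x, A x & f x = y) is left e
            then sval (cid2 e) else a.
have gP x : A x -> g (f x) = x.
  move=> Ax; rewrite /g; case: pselect => [e|[]]; last by exists x.
  by case: (cid2 e) => /= z Az fz; apply: finj.
exists g => [y By|x Ax]; last by exists (f x); [exact: fAB | exact: gP].
by rewrite /g; case: pselect => [e|//]; case: (cid2 e).
Qed.

Lemma card_le_of_surj (T U : Type) (A : set T) (B : set U) (g : U -> T) :
  (forall x, A x -> exists2 y, B y & g y = x) -> A #<= B.
Proof.
move=> gsurj; apply: card_le_trans (card_image_le g B).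
by apply: subset_card_le => x /gsurj[y By <-]; exists y.
Qed.

Lemma card_leX (T U T' U' : Type) (A : set T) (B : set U) (A' : set T')
    (B' : set U') : A #<= A' -> B #<= B' -> A `*` B #<= A' `*` B'.
Proof.
move=> AA' BB'.
have [A0|[a Aa]] : A = set0 \/ A !=set0.
  by have [->|/set0P] := eqVneq A set0; [left|right].
  by rewrite A0 set0X.
have [B0|[b Bb]] : B = set0 \/ B !=set0.
  by have [->|/set0P] := eqVneq B set0; [left|right].
  by rewrite B0 setX0.
have [f fA fs] := surj_of_card_le AA' (ex_intro _ a Aa).
have [g gB gs] := surj_of_card_le BB' (ex_intro _ b Bb).
apply: (@card_le_of_surj _ _ _ _ (fun z => (f z.1, g z.2))) => -[x y] /= [Ax By].
have [x' A'x' <-] := fs _ Ax; have [y' B'y' <-] := gs _ By.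
by exists (x', y').
Qed.

(** A maximal partial injection, given by Zorn's lemma, is defined on all of [A] or reaches all of
    [B], since otherwise one more pair could be added. *)
Lemma card_le_total (T U : Type) (A : set T) (B : set U) :
  A #<= B \/ B #<= A.
Proof.
pose P (G : set (T * U)) :=
  [/\ forall z, G z -> A z.1 /\ B z.2,
      forall z z', G z -> G z' -> z.1 = z'.1 -> z = z'
    & forall z z', G z -> G z' -> z.2 = z'.2 -> z = z'].
have [|G [[GAB Gfun Ginj] Gmax]] := @Zorn_bigcup _ P.
  move=> F FP Ftot; split.
  - by move=> z [X /FP[XAB _ _]]; exact: XAB.
  - move=> z z' [X FX Xz] [X' FX' X'z'].
    by have [XX'|XX'] := Ftot _ _ FX FX';
      [have [_ + _] := FP _ FX'|have [_ + _] := FP _ FX]; apply => //; apply: XX'.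
  - move=> z z' [X FX Xz] [X' FX' X'z'].
    by have [XX'|XX'] := Ftot _ _ FX FX';
      [have [_ _ +] := FP _ FX'|have [_ _ +] := FP _ FX]; apply => //; apply: XX'.
have [domG|/existsNP[a /not_implyP[Aa aG]]] :=
  pselect (forall x, A x -> exists y, G (x, y)).
  left; have [u|] := pselect (exists u : U, True); last first.
    move=> noU; apply: (@card_le_of_surj _ _ _ _ (fun u : U => False_rect T (noU (ex_intro _ u I)))).
    by move=> x /domG[y _]; case: noU; exists y.
  pose f x := if pselect (exists y, G (x, y)) is left e then sval (cid e)
              else sval (cid u).
  have fP x : A x -> G (x, f x).
    by move=> /domG ex; rewrite /f; case: pselect => // e; case: (cid e).
  apply: (@card_le_of_inj _ _ _ _ f) => [x /fP/GAB[]//|x y /fP Gx /fP Gy fxy].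
  by have [] := Ginj _ _ Gx Gy fxy.
have [ranG|/existsNP[b /not_implyP[Bb bG]]] :=
  pselect (forall y, B y -> exists x, G (x, y)).
  right; pose f y := if pselect (exists x, G (x, y)) is left e then sval (cid e)
              else a.
  have fP y : B y -> G (f y, y).
    by move=> /ranG ex; rewrite /f; case: pselect => // e; case: (cid e).
  apply: (@card_le_of_inj _ _ _ _ f) => [y /fP/GAB[]//|x y /fP Gx /fP Gy fxy].
  by have [] := Gfun _ _ Gx Gy fxy.
case: (Gmax ((a, b) |` G)).
  split=> [|sub]; first by move=> z; right.
  by apply: aG; exists b; apply: sub; left.
split.
- by move=> z [->|/GAB].
- move=> z z' [->|Gz] [->|Gz'] //=; last exact: Gfun.
    by move=> az; case: aG; exists z'.2; rewrite az -surjective_pairing.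
  by move=> az; case: aG; exists z.2; rewrite -az -surjective_pairing.
- move=> z z' [->|Gz] [->|Gz'] //=; last exact: Ginj.
    by move=> az; case: bG; exists z'.1; rewrite az -surjective_pairing.
  by move=> az; case: bG; exists z.1; rewrite -az -surjective_pairing.
Qed.

Lemma card_setU_le (T U : Type) (A B : set T) (C : set U) : infinite_set C ->
  C `*` C #<= C -> A #<= C -> B #<= C -> A `|` B #<= C.
Proof.
move=> Cinf CC AC BC.
apply: card_le_trans CC.
have [A0|/set0P An0] := eqVneq A set0.
  rewrite A0 set0U; apply: card_le_trans BC _.
  have [c Cc] := infinite_setN0 Cinf.
  by apply: (@card_le_of_inj _ _ _ _ (fun x => (x, c))) => // x y _ _ [].
have [B0|/set0P Bn0] := eqVneq B set0.
  rewrite B0 setU0; apply: card_le_trans AC _.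
  have [c Cc] := infinite_setN0 Cinf.
  by apply: (@card_le_of_inj _ _ _ _ (fun x => (x, c))) => // x y _ _ [].
have [f fA fs] := surj_of_card_le AC An0.
have [g gA gs] := surj_of_card_le BC Bn0.
have [c Cc] := infinite_setN0 Cinf.
(* Two distinct elements of [C] serve as tags for the two pieces of the union. *)
have [c' [Cc' c'c]] : exists c', C c' /\ c' <> c.
  apply: contrapT => h; apply: Cinf; apply: sub_finite_set (finite_set1 c).
  by move=> x Cx; apply: contrapT => xc; apply: h; exists x.
apply: (@card_le_of_surj _ _ _ _ (fun z => if `[< z.1 = c >] then f z.2 else g z.2)).
move=> x [/fs[y Cy <-]|/gs[y Cy <-]].
  by exists (c, y) => //=; case: asboolP.
by exists (c', y) => //=; case: asboolP.
Qed.

(* Hessenberg: a maximal partial pairing [F x F -> F] with [F] infinite has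
   [S \ F] smaller than [F], since otherwise it extends to [F] together with a
   copy of [F] inside [S \ F]. *)
Theorem card_infiniteX (T : Type) (S : set T) : infinite_set S ->
  S `*` S #<= S.
Proof.
move=> Sinf.
pose F (G : set (T * T * T)) x := exists z, G (x, x, z).
pose nice (G : set (T * T * T)) :=
  [/\ forall q, G q -> [/\ F G q.1.1, F G q.1.2, F G q.2 & S q.2],
      forall x y, F G x -> F G y -> exists z, G (x, y, z),
      forall q q', G q -> G q' -> q.1 = q'.1 -> q = q',
      forall q q', G q -> G q' -> q.2 = q'.2 -> q = q'
    & F G `<=` S].
pose P G := G = set0 \/ nice G /\ infinite_set (F G).
(* A copy in [S] of a pairing of [nat]; it will show that the maximal graph is not empty. *)
have [G0 [G0nice G0inf]] : exists G0, nice G0 /\ infinite_set (F G0).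
  have [h hS hinj] := inj_of_card_le ((infiniteP S).1 Sinf) (infinite_setN0 Sinf).
  have /card_eqPle[le2 _] := card_nat2.
  have [p _ pinj] := inj_of_card_le le2 (ex_intro _ 0%N I).
  pose G := [set q | exists i j, q = (h i, h j, h (p (i, j)))].
  have FG x : F G x <-> exists i, x = h i.
    split=> [[z [i [j [-> _ _]]]]|[i ->]]; first by exists i.
    by exists (h (p (i, i))), i, i.
  exists G; split; [split|].
  - move=> _ [i [j ->]] /=; split; try (by apply/FG; eexists); exact: hS.
  - by move=> x y /FG[i ->] /FG[j ->]; exists (h (p (i, j))), i, j.
  - by move=> _ _ [i [j ->]] [i' [j' ->]] /= [/(hinj _ _ I I)<- /(hinj _ _ I I)<-].
  - move=> _ _ [i [j ->]] [i' [j' ->]] /=.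
    by move=> /(hinj _ _ I I)/(pinj _ _ I I) [<- <-].
  - by move=> x /FG[i ->]; exact: hS.
  apply/infiniteP; apply: (@card_le_of_inj _ _ _ _ h) => [i _|i j _ _]; last exact: hinj.
  by apply/FG; exists i.
have [|G [GP Gmax]] := @Zorn_bigcup _ P.
  move=> C CP Ctot.
  have [C0|/existsNP[X0 /not_implyP[CX0 X0n0]]] :=
      pselect (forall X, C X -> X = set0).
    by left; rewrite eqEsubset; split=> // q [X /C0->].
  have Fbig x : F (\bigcup_(X in C) X) x <-> exists2 X, C X & F X x.
    by split=> [[z [X CX Xz]]|[X CX [z Xz]]]; [exists X => //; exists z|exists z, X].
  have C2 X Y : C X -> C Y -> X !=set0 -> exists Z, [/\ C Z, X `<=` Z, Y `<=` Z & nice Z].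
    move=> CX CY [q Xq]; have [XY|YX] := Ctot _ _ CX CY.
      exists Y; split=> //; have [Y0|[]//] := CP _ CY.
      by have := XY _ Xq; rewrite Y0.
    by exists X; split=> //; have [XE|[]//] := CP _ CX; move: Xq; rewrite XE.
  have F2 X Y x : X `<=` Y -> F X x -> F Y x by move=> XY [z Xz]; exists z; apply: XY.
  right; split; [split|].
  - move=> q [X CX Xq]; have [XE|[[Xn _ _ _ _] _]] := CP _ CX.
      by move: Xq; rewrite XE.
    by have [????] := Xn _ Xq; split=> //; apply/Fbig; exists X.
  - move=> x y /Fbig[X CX [z Xz]] /Fbig[Y CY FYy].
    have [Z [CZ XZ YZ [_ Zn _ _ _]]] := C2 _ _ CX CY (ex_intro _ _ Xz).
    have [|z' Zz'] := Zn x y _ (F2 _ _ _ YZ FYy); first by exists z; apply: XZ.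
    by exists z', Z.
  - move=> q q' [X CX Xq] [Y CY Yq'].
    have [Z [CZ XZ YZ [_ _ Zn _ _]]] := C2 _ _ CX CY (ex_intro _ _ Xq).
    by apply: Zn; [apply: XZ|apply: YZ].
  - move=> q q' [X CX Xq] [Y CY Yq'].
    have [Z [CZ XZ YZ [_ _ _ Zn _]]] := C2 _ _ CX CY (ex_intro _ _ Xq).
    by apply: Zn; [apply: XZ|apply: YZ].
  - move=> x /Fbig[X CX FXx]; have [XE|[[_ _ _ _ Xn] _]] := CP _ CX; last exact: Xn.
    by move: FXx; rewrite XE => -[].
  have [//|[_ Finf]] := CP _ CX0.
  by apply: sub_infinite_set Finf => x Fx; apply/Fbig; exists X0.
case: GP => [GE|[[Gd Gtot Gfun Ginj GS] Finf]].
  case: (Gmax G0); last by right.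
  rewrite GE; split; first by [].
  move=> G00; have [x [z Gz]] := infinite_setN0 G0inf; exact: G00 Gz.
have FF : F G `*` F G #<= F G.
  have [x0 _] := infinite_setN0 Finf.
  pose f w := if pselect (exists z, G (w, z)) is left e then sval (cid e) else x0.
  have fP w : (F G `*` F G) w -> G (w, f w).
    case: w => x y [/= Fx /(Gtot _ _ Fx) ex]; rewrite /f.
    by case: pselect => // e; case: (cid e).
  apply: (@card_le_of_inj _ _ _ _ f) => [w /fP/Gd[]//|w w' /fP Gw /fP Gw' ff].
  by have [] := Ginj _ _ Gw Gw' ff.
have [SF|FS] := card_le_total (S `\` F G) (F G).
  have SleF : S #<= F G.
    apply: card_le_trans (card_setU_le Finf FF SF (card_lexx _)).
    by apply: subset_card_le => x Sx; have [|] := pselect (F G x); [right|left].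
  apply: card_le_trans (card_leX SleF SleF) _.
  exact: card_le_trans FF (subset_card_le GS).
exfalso.
have [|h hSF hinj] := inj_of_card_le FS.
  have [SF0|/set0P//] := eqVneq (S `\` F G) set0.
  by move: FS; rewrite SF0 => /card_le0P F0; move: Finf; rewrite F0.
pose S' := h @` F G; pose F' := F G `|` S'.
have S'inf : F G #<= S' .
  by apply: (@card_le_of_inj _ _ _ _ h) => [x Fx|]; [exists x|exact: hinj].
have F'F : F' #<= F G.
  exact: card_setU_le Finf FF (card_lexx _) (card_image_le _ _).
have : F' `*` F' `\` F G `*` F G #<= S'.
  apply: card_le_trans (card_le_setD _ _) _.
  apply: card_le_trans (card_leX F'F F'F) _.
  exact: card_le_trans FF S'inf.
have [s Fs] := infinite_setN0 Finf.
case/inj_of_card_le; first by exists (h s), s.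
move=> e eS' einj.
have S'F x : S' x -> ~ F G x by move=> [y /hSF[]] + + <-.
have S'S x : S' x -> S x by move=> [y /hSF[]] + + <-.
(* The new values lie in [S'], which is disjoint from [F G], so [G'] stays injective. *)
pose G' := G `|` [set q | (F' `*` F' `\` F G `*` F G) q.1 /\ q.2 = e q.1].
have FG' x : F G' x <-> F' x.
  split=> [[z [Gz|[[[F'x _] _] _]]]//|[[z Gz]|S'x]].
  - by left; exists z.
  - by exists z; left.
  - exists (e (x, x)); right; split=> //; split; first by split; right.
    by move=> [/= Fx _]; exact: S'F S'x Fx.
case: (Gmax G').
  split; first by move=> q; left.
  move=> /(_ (h s, h s, e (h s, h s))) G'G.
  have : G (h s, h s, e (h s, h s)).
    apply: G'G; right; split=> //; split; first by split; right; exists s.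
    by move=> [/= Fx _]; apply: S'F Fx; exists s.
  by move=> /Gd[/= Fx _ _ _]; apply: S'F Fx; exists s.
right; split; [split|].
- move=> q [/Gd[Fx Fy Fz Sz]|[[[F'x F'y] n] ez]].
    by split=> //; apply/FG'; left.
  have S'e := eS' _ (conj (conj F'x F'y) n).
  by split; [apply/FG'|apply/FG'|apply/FG'; right; rewrite ez|rewrite ez; apply: S'S].
- move=> x y /FG' F'x /FG' F'y; have [[Fx Fy]|n] := pselect ((F G `*` F G) (x, y)).
    by have [z Gz] := Gtot _ _ Fx Fy; exists z; left.
  by exists (e (x, y)); right.
- move=> q q' [Gq|[[n n'] eq]] [Gq'|[[m m'] eq']].
  + exact: Gfun.
  + by move=> qq; case: m'; rewrite -qq; have [] := Gd _ Gq.
  + by move=> qq; case: n'; rewrite qq; have [] := Gd _ Gq'.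
  + by move=> qq; rewrite [q]surjective_pairing [q']surjective_pairing eq eq' qq.
- move=> q q' [Gq|[n eq]] [Gq'|[m eq']].
  + exact: Ginj.
  + move=> qq; have [_ _ Fq _] := Gd _ Gq.
    by case: (S'F q.2) => //; rewrite qq eq'; apply: eS'.
  + move=> qq; have [_ _ Fq _] := Gd _ Gq'.
    by case: (S'F q'.2) => //; rewrite -qq eq; apply: eS'.
  + rewrite eq eq' => /(einj _ _ n m) qq.
    by rewrite [q]surjective_pairing [q']surjective_pairing eq eq' qq.
- by move=> x /FG'[/GS|/S'S].
apply: sub_infinite_set Finf => x Fx; apply/FG'; left; exact: Fx.
Qed.

Lemma card_bigcup_le (I T U : Type) (B : set I) (F : I -> set T) (S : set U) :
  infinite_set S -> B #<= S -> (forall b, B b -> F b #<= S) ->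
  \bigcup_(b in B) F b #<= S.
Proof.
move=> Sinf BS FS; apply: card_le_trans (card_infiniteX Sinf).
have [B0|/set0P Bn0] := eqVneq B set0.
  by rewrite B0 bigcup_set0.
have [g gB gs] := surj_of_card_le BS Bn0.
have [U0|/set0P[t0 _]] := eqVneq (\bigcup_(b in B) F b) set0.
  by rewrite U0.
have fE b : exists f : U -> T, B b -> forall x, F b x -> exists2 y, S y & f y = x.
  have [Bb|] := pselect (B b); last by exists (fun=> t0).
  have [F0|/set0P Fn0] := eqVneq (F b) set0; first by exists (fun=> t0); rewrite F0.
  by have [f _ fs] := surj_of_card_le (FS _ Bb) Fn0; exists f.
have [f fP] := choice fE.
apply: (@card_le_of_surj _ _ _ _ (fun z => f (g z.1) z.2)) => x [b Bb Fx].
have [i Si gi] := gs _ Bb; have [y Sy fy] := fP _ Bb _ Fx.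
by exists (i, y) => //=; rewrite gi.
Qed.

(** * Ideals and half graphs *)

(** Stands in for a bound on the size of [B], so that the ideal of sets of bounded size and the
    ideal of noncofinal sets are treated alike. *)
Definition few (D I : Type) (J : set D -> Prop) (B : set I) : Prop :=
  forall F : I -> set D, (forall b, B b -> J (F b)) ->
  J (\bigcup_(b in B) F b).

Definition ideal (D : Type) (J : set D -> Prop) : Prop :=
  [/\ forall S S', S `<=` S' -> J S' -> J S, J set0 & few J [set: bool]].

Section IdealTheory.
Variables (D : Type) (J : set D -> Prop).
Hypothesis idJ : ideal J.

Lemma ideal_sub S S' : S `<=` S' -> J S' -> J S.
Proof. by case: idJ => + _ _; apply. Qed.

Lemma idealU S S' : J S -> J S' -> J (S `|` S').
Proof.
move=> JS JS'; have [_ _ J2] := idJ.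
have JB : J (\bigcup_(b in [set: bool]) (if b then S else S')) by apply: J2 => -[].
by apply: ideal_sub JB => x [Sx|S'x]; [exists true|exists false].
Qed.

Lemma ideal_bigcup_ltn n (F : nat -> set D) : (forall i, i < n -> J (F i)) ->
  J [set x | exists2 i, i < n & F i x].
Proof.
elim: n => [|n IHn] JF.
  by have [_ J0 _] := idJ; apply: ideal_sub J0 => x [].
have JU := idealU (IHn (fun i lt_in => JF i (ltnW lt_in))) (JF n (ltnSn n)).
apply: ideal_sub JU => x [i]; rewrite ltnS leq_eqVlt.
by case/predU1P=> [->|lt_in] Fx; [right|left; exists i].
Qed.

Lemma few_sub (I : Type) (B B' : set I) : B `<=` B' -> few J B' -> few J B.
Proof.
move=> BB' fB' F JF.
have JU : J (\bigcup_(b in B') [set x | B b /\ F b x]).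
  apply: fB' => b _; have [Bb|nBb] := pselect (B b).
    by apply: ideal_sub (JF _ Bb) => x [].
  by have [_ J0 _] := idJ; apply: ideal_sub J0 => x [].
by apply: ideal_sub JU => x [b Bb Fx]; exists b => //; apply: BB'.
Qed.

Lemma few_image (I I' : Type) (f : I -> I') (B : set I) :
  few J B -> few J (f @` B).
Proof.
move=> fB F JF; have JU : J (\bigcup_(b in B) F (f b)).
  by apply: fB => b Bb; apply: JF; exists b.
by apply: ideal_sub JU => x [_ [b Bb <-] Fx]; exists b.
Qed.

Lemma few_setU (I : Type) (B B' : set I) :
  few J B -> few J B' -> few J (B `|` B').
Proof.
move=> fB fB' F JF; rewrite bigcup_setU; apply: idealU.
  by apply: fB => b Bb; apply: JF; left.
by apply: fB' => b Bb; apply: JF; right.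
Qed.

Lemma few_setX (I I' : Type) (B : set I) (B' : set I') :
  few J B -> few J B' -> few J (B `*` B').
Proof.
move=> fB fB' F JF.
have JU : J (\bigcup_(b in B) \bigcup_(b' in B') F (b, b')).
  by apply: fB => b Bb; apply: fB' => b' Bb'; apply: JF.
by apply: ideal_sub JU => x [[b b'] [Bb Bb'] Fx]; exists b => //; exists b'.
Qed.

(** Only [m] coordinates of [u] matter, so this is a union over [B] iterated [m] times. *)
Lemma few_valuations (V : Type) (B : set V) m (F : (nat -> V) -> set D) :
  few J B ->
  (forall u u', (forall i, i < m -> u i = u' i) -> F u = F u') ->
  (forall u, (forall i, B (u i)) -> J (F u)) ->
  J [set x | exists2 u, forall i, B (u i) & F u x].
Proof.
move=> fB; elim: m F => [|m IHm] F Fm JF.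
  have [[u Bu]|nou] := pselect (exists u : nat -> V, forall i, B (u i)).
    by apply: ideal_sub (JF u Bu) => x [u' _]; rewrite (Fm u' u).
  by have [_ J0 _] := idJ; apply: ideal_sub J0 => x [u Bu]; case: nou; exists u.
have JU : J (\bigcup_(b in B)
    [set x | exists2 u, forall i, B (u i) & F (update u m b) x]).
  apply: fB => b Bb; apply: (IHm (fun u => F (update u m b))) => [u u' uu'|u Bu].
    apply: Fm => i; rewrite ltnS leq_eqVlt /update.
    by case: eqVneq => //= _; apply: uu'.
  by apply: JF => i; rewrite /update; case: eqP.
apply: ideal_sub JU => x [u Bu Fu]; exists (u m) => //; exists u => //.
rewrite (Fm _ u) // => i _; rewrite /update.
by case: eqP => // ->.
Qed.

End IdealTheory.

Lemma update_same (D : Type) (v : nat -> D) x a : update v x a x = a.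
Proof. by rewrite /update eqxx. Qed.

Lemma update_neq (D : Type) (v : nat -> D) x y a : y <> x -> update v x a y = v y.
Proof. by rewrite /update; case: eqP. Qed.

Lemma updateK (D : Type) (v : nat -> D) x a b :
  update (update v x a) x b = update v x b.
Proof. by apply/funext => y; rewrite /update; case: eqP. Qed.

Lemma updateC (D : Type) (v : nat -> D) x y a b : x <> y ->
  update (update v x a) y b = update (update v y b) x a.
Proof.
move=> xy; apply/funext => z; rewrite /update.
by case: eqP => // ->; case: eqP => // yx; case: xy.
Qed.

Lemma update_id (D : Type) (v : nat -> D) x : update v x (v x) = v.
Proof. by apply/funext => y; rewrite /update; case: eqP => [->|]. Qed.

Definition mix (V : Type) (p : pred nat) (a b : nat -> V) : nat -> V :=
  fun x => if p x then a x else b x.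

Definition half_graph (V : Type) (R : (nat -> V) -> Prop) (p : pred nat)
    (N : nat) (a b : nat -> nat -> V) : Prop :=
  forall i j, i < N -> j < N -> R (mix p (a i) (b j)) <-> i < j.

(** A finite bound for each [p], and not only the absence of infinite half graphs: to preserve it
    under a generic quantifier, only finitely many small sets have to be avoided. *)
Definition stable_rel (V : Type) (R : (nat -> V) -> Prop) : Prop :=
  forall p, exists N, forall a b, ~ half_graph R p N a b.

Lemma stable_rename (V : Type) (R : (nat -> V) -> Prop) (s : nat -> nat) :
  stable_rel R -> stable_rel (fun u => R (u \o s)).
Proof.
move=> stR p; have [N HN] := stR (p \o s); exists N => a b hg.
by apply: (HN (fun i => a i \o s) (fun j => b j \o s)) => i j iN jN; apply: hg.
Qed.

Lemma stable_map (V V' : Type) (f : V -> V') (R : (nat -> V') -> Prop) :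
  stable_rel R -> stable_rel (fun u => R (f \o u)).
Proof.
move=> stR p; have [N HN] := stR p; exists N => a b hg.
apply: (HN (fun i => f \o a i) (fun j => f \o b j)) => i j iN jN.
rewrite -(hg i j iN jN).
suff -> : mix p (f \o a i) (f \o b j) = f \o mix p (a i) (b j) by [].
by apply/funext => x; rewrite /mix /=; case: ifP.
Qed.


Section Ladder.
Variables (D U : Type) (J : set D -> Prop) (T : D -> U -> Prop).
Hypothesis idJ : ideal J.

Let rich (Z : set D) (P : set U) : Prop :=
  ~ J Z /\ forall Z', Z' `<=` Z -> ~ J Z' ->
    exists u, [/\ P u, ~ J (Z' `&` [set x | T x u]) & ~ J (Z' `\` [set x | T x u])].

(* If the parameters in [P1] fail to split some nonsmall [Z1], then they fail
   on all of its nonsmall subsets, so those in [P2] must split them. *)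
Let rich_setU Z P1 P2 : rich Z (P1 `|` P2) ->
  exists2 Z', Z' `<=` Z & rich Z' P1 \/ rich Z' P2.
Proof.
move=> [JZ spZ]; have [r1|] := pselect (rich Z P1); first by exists Z => //; left.
move=> /not_andP[//|/existsNP[Z1 /not_implyP[Z1Z /not_implyP[JZ1 nosp]]]].
exists Z1 => //; right; split=> // Z2 Z21 JZ2.
have [|u [[P1u|P2u] Jt Jf]] := spZ Z2 _ JZ2; first exact: subset_trans Z1Z.
  case: nosp; exists u; split=> // JJ; [apply: Jt|apply: Jf].
    by apply: ideal_sub JJ => // x [/Z21].
  by apply: ideal_sub JJ => // x [/Z21].
by exists u.
Qed.

(** Fix [x] in [Z] and sort the parameters by the truth of [T x u]. One sort stays rich on some
    [Z1]; a [u] of that sort splits [Z1], and the induction continues on the half where [T] takes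
    the value opposite to [T x u]. Prepending [x] and [u] lengthens the first kind of ladder if
    [T x u] holds and the second kind otherwise; a ladder of the other kind is already long
    enough. *)
Let ladder n m Z P : rich Z P ->
  (exists x u, [/\ forall i, i < n -> Z (x i), forall i, i < n -> P (u i)
    & forall i j, i < n -> j < n -> T (x i) (u j) <-> i <= j]) \/
  (exists x u, [/\ forall i, i < m -> Z (x i), forall i, i < m -> P (u i)
    & forall i j, i < m -> j < m -> T (x i) (u j) <-> j < i]).
Proof.
have ne Z1 P1 : rich Z1 P1 -> exists x, Z1 x.
  move=> [JZ1 _]; apply: contrapT => noz; apply: JZ1.
  by have [_ J0 _] := idJ; apply: ideal_sub J0 => // x Zx; apply: noz; exists x.
have sh A (Q : set A) (a : A) (s : nat -> A) k : Q a -> (forall i, i < k -> Q (s i)) ->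
    forall i, i < k.+1 -> Q (if i is i'.+1 then s i' else a).
  by move=> Qa Qs [|i] //; apply: Qs.
elim: n m Z P => [|n IHn] m Z P.
  move=> /[dup] /ne[x _] [JZ spZ]; left.
  by have [//|u _] := spZ Z _ JZ; exists (fun=> x), (fun=> u).
elim: m Z P => [|m IHm] Z P.
  move=> /[dup] /ne[x _] [JZ spZ]; right.
  by have [//|u _] := spZ Z _ JZ; exists (fun=> x), (fun=> u).
move=> /[dup] rZ /ne[x Zx].
have [|Z1 Z1Z [r1|r1]] := @rich_setU Z (P `&` T x) (P `\` T x).
- by rewrite setUIDK.
- have [JZ1 sp1] := r1; have [//|u [[Pu Txu] Jt Jf]] := sp1 Z1 _ JZ1.
  have [|[y [v [yZ vP yv]]]|[y [v [yZ vP yv]]]] :=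
      IHn m.+1 (Z1 `\` [set x | T x u]) (P `&` T x).
  + by split=> // Z2 Z21; apply: sp1; apply: subset_trans Z21 _; apply: subDsetl.
  + left; exists (fun i => if i is i'.+1 then y i' else x).
    exists (fun i => if i is i'.+1 then v i' else u); split.
    * by apply: sh => // i /yZ[/Z1Z].
    * by apply: sh => // i /vP[].
    * move=> [|i] [|j] //= iN jN; first by split=> // _; have [] := vP _ jN.
        by split=> // Ty; have [_ []] := yZ _ iN.
      exact: yv.
  + right; exists y, v; split=> // i; first by move=> /yZ[/Z1Z].
    by move=> /vP[].
- have [JZ1 sp1] := r1; have [//|u [[Pu Txu] Jt Jf]] := sp1 Z1 _ JZ1.
  have [|[y [v [yZ vP yv]]]|[y [v [yZ vP yv]]]] :=
      IHm (Z1 `&` [set x | T x u]) (P `\` T x).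
  + by split=> // Z2 Z21; apply: sp1; apply: subset_trans Z21 _; apply: subIsetl.
  + left; exists y, v; split=> // i; first by move=> /yZ[/Z1Z].
    by move=> /vP[].
  + right; exists (fun i => if i is i'.+1 then y i' else x).
    exists (fun i => if i is i'.+1 then v i' else u); split.
    * by apply: sh => // i /yZ[/Z1Z].
    * by apply: sh => // i /vP[].
    * move=> [|i] [|j] //= iN jN; first by split=> // ?; have [_ []] := vP _ jN.
        by split=> // _; have [] := yZ _ iN.
      exact: yv.
Qed.

Lemma split_ladder n m Z : ~ J Z ->
  (forall Z', Z' `<=` Z -> ~ J Z' -> exists u,
    ~ J (Z' `&` [set x | T x u]) /\ ~ J (Z' `\` [set x | T x u])) ->
  (exists x u, forall i j, i < n -> j < n -> T (x i) (u j) <-> i <= j) \/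
  (exists x u, forall i j, i < m -> j < m -> T (x i) (u j) <-> j < i).
Proof.
move=> JZ spZ; have rZ : rich Z setT.
  by split=> // Z' Z'Z JZ'; have [u []] := spZ _ Z'Z JZ'; exists u.
by have [[x [u []]]|[x [u []]]] := ladder n m rZ; [left|right]; exists x, u.
Qed.

End Ladder.

(** * Generic quantifiers *)

Section Quantifiers.
Variables (K D : Type) (J : K -> set D -> Prop).
Hypothesis idJ : forall k, ideal (J k).
Implicit Types (Z : K -> set D) (T : (nat -> K * D) -> Prop) (u : nat -> K * D).

(* A variable carries an index in [K] and a value in [D]; [put] changes the
   value only, and the index selects the set over which the variable is
   quantified. *)
Definition put u n (x : D) : nat -> K * D := update u n ((u n).1, x).

Lemma putK u n x y : put (put u n x) n y = put u n y.
Proof. by rewrite /put updateK update_same. Qed.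

Lemma put_fst u n x i : (put u n x i).1 = (u i).1.
Proof. by rewrite /put /update; case: eqP => // ->. Qed.

Lemma putC u n m x y : n <> m -> put (put u n x) m y = put (put u m y) n x.
Proof.
by move=> nm; rewrite {1 3}/put !put_fst /put updateC.
Qed.

Definition decides Z T n : Prop := forall u,
  J (u n).1 [set x | Z (u n).1 x /\ T (put u n x)] \/
  J (u n).1 [set x | Z (u n).1 x /\ ~ T (put u n x)].

Definition Q Z n T : (nat -> K * D) -> Prop :=
  fun u => J (u n).1 [set x | Z (u n).1 x /\ ~ T (put u n x)].

Definition nonsmall Z : Prop := forall k, ~ J k (Z k).

Definition exceptions Z n T u : set D :=
  [set x | Z (u n).1 x /\ ~ (T (put u n x) <-> Q Z n T u)].

Lemma small_exceptions Z n T u : decides Z T n -> J (u n).1 (exceptions Z n T u).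
Proof.
move=> dZ; have [QT|nQT] := pselect (Q Z n T u).
  by apply: (ideal_sub (idJ _) _ QT) => x [Zx nT]; split=> // Tx; apply: nT.
have [JT|//] := dZ u.
by apply: (ideal_sub (idJ _) _ JT) => x [Zx nT]; split=> //; apply: contrapT => nTx; apply: nT.
Qed.

Lemma nonsmall_ex Z k : nonsmall Z -> exists x, Z k x.
Proof.
move=> nZ; apply: contrapT => h; apply: (nZ k).
by have [_ J0 _] := idJ k; apply: (ideal_sub (idJ k) _ J0) => x Zx; apply: h; exists x.
Qed.

Lemma pick_nonsmall Z k N (F : nat -> set D) : nonsmall Z ->
  (forall i, i < N -> J k (F i)) -> exists2 x, Z k x & forall i, i < N -> ~ F i x.
Proof.
move=> nZ JF; apply: contrapT => h; apply: (nZ k).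
apply: (ideal_sub (idJ k) _ (ideal_bigcup_ltn (idJ k) JF)) => x Zx.
apply: contrapT => nF; apply: h; exists x => // i iN Fx; apply: nF.
by exists i.
Qed.

Lemma Q_not Z n T u : nonsmall Z -> decides Z T n ->
  ~ Q Z n T u -> Q Z n (fun v => ~ T v) u.
Proof.
move=> nZ dZ nQ; have [JT|//] := dZ u.
by apply: (ideal_sub (idJ _) _ JT) => x [Zx /contrapT].
Qed.

Lemma Q_put Z n T u x : Q Z n T (put u n x) = Q Z n T u.
Proof. by rewrite /Q put_fst; under eq_set do rewrite putK. Qed.

Lemma stable_Q Z n T : nonsmall Z -> decides Z T n -> stable_rel T ->
  stable_rel (Q Z n T).
Proof.
move=> nZ dZ stT p; have [N HN] := stT p; exists N => a b hg.
(* Choose the value of [n] generically on the side of the partition that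
   contains it, for all pairs of rows at once. *)
have pick (F : nat -> nat -> set D) (k : nat -> K) :
    (forall i j, i < N -> j < N -> J (k i) (F i j)) ->
    exists x : nat -> D, forall i, Z (k i) (x i) /\
      forall j, i < N -> j < N -> ~ F i j (x i).
  move=> JF; suff /choice[x] : forall i, exists x, Z (k i) x /\
      forall j, i < N -> j < N -> ~ F i j x by exists x.
  move=> i.
  have [iN|_] := boolP (i < N); last by have [x Zx] := nonsmall_ex (k i) nZ; exists x.
  have [x Zx xF] := pick_nonsmall nZ (fun j => @JF i j iN).
  by exists x; split=> // j _; apply: xF.
have [pn|pn] := boolP (p n).
  have [|x xP] := pick (fun i j => exceptions Z n T (mix p (a i) (b j)))
                       (fun i => (a i n).1).
    move=> i j _ _; have := small_exceptions (mix p (a i) (b j)) dZ.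
    by rewrite {1}/mix pn.
  apply: (HN (fun i => put (a i) n (x i)) b) => i j iN jN.
  rewrite -(hg i j iN jN).
  have -> : mix p (put (a i) n (x i)) (b j) = put (mix p (a i) (b j)) n (x i).
    by apply/funext => y; rewrite /mix /put /update pn; case: eqP => // ->; rewrite pn.
  have [Zx /(_ j iN jN) nF] := xP i; apply: contrapT => nT; apply: nF; split=> //.
  by rewrite /mix pn.
have [|x xP] := pick (fun j i => exceptions Z n T (mix p (a i) (b j)))
                     (fun j => (b j n).1).
  move=> j i _ _; have := small_exceptions (mix p (a i) (b j)) dZ.
  by rewrite {1}/mix (negbTE pn).
apply: (HN a (fun j => put (b j) n (x j))) => i j iN jN.
rewrite -(hg i j iN jN).
have -> : mix p (a i) (put (b j) n (x j)) = put (mix p (a i) (b j)) n (x j).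
  apply/funext => y; rewrite /mix /put /update (negbTE pn).
  by case: eqP => // ->; rewrite (negbTE pn).
have [Zx /(_ i jN iN) nF] := xP j; apply: contrapT => nT; apply: nF; split=> //.
by rewrite /mix (negbTE pn).
Qed.

Lemma decides_sub Z Z' T n : (forall k, Z' k `<=` Z k) -> decides Z T n ->
  decides Z' T n.
Proof.
move=> Z'Z dZ u; case: (dZ u) => JT; [left|right];
  by apply: (ideal_sub (idJ _) _ JT) => x [/Z'Z].
Qed.

(** If [T] held almost everywhere on [Z'] and almost nowhere on [Z], then [Z'] would be a union of
    two small sets. Hence the sets can be shrunk repeatedly without changing the quantified
    relations already formed. *)
Lemma Q_sub Z Z' T n : (forall k, Z' k `<=` Z k) -> nonsmall Z' ->
  decides Z T n -> Q Z' n T = Q Z n T.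
Proof.
move=> Z'Z nZ' dZ; apply/funext => u; apply/propext; split; last first.
  by apply: (ideal_sub (idJ _)) => x [/Z'Z].
move=> QT; case: (dZ u) => // JT; case: (nZ' (u n).1).
apply: (ideal_sub (idJ _) _ (idealU (idJ _) QT JT)) => x Zx.
by have [Tx|nTx] := pselect (T (put u n x)); [right|left]; split=> //; apply: Z'Z.
Qed.

Lemma decides_exists Z T n : nonsmall Z -> stable_rel T ->
  exists Z', [/\ forall k, Z' k `<=` Z k, nonsmall Z' & decides Z' T n].
Proof.
move=> nZ stT; have [N HN] := stT (pred1 n).
have : forall k, exists Y, [/\ Y `<=` Z k, ~ J k Y & forall u, (u n).1 = k ->
    J k [set x | Y x /\ T (put u n x)] \/ J k [set x | Y x /\ ~ T (put u n x)]].
  move=> k; apply: contrapT => h.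
  have sp Y : Y `<=` Z k -> ~ J k Y -> exists u : nat -> K * D,
      ~ J k (Y `&` [set x | T (update u n (k, x))]) /\
      ~ J k (Y `\` [set x | T (update u n (k, x))]).
    move=> YZ nY; apply: contrapT => nosp; apply: h; exists Y; split=> // u uk.
    apply: contrapT => /not_orP[h1 h2]; apply: nosp; exists u.
    by split=> JJ; [apply: h1|apply: h2];
      apply: (ideal_sub (idJ _) _ JJ) => x; rewrite /put uk.
  have mixE (x : D) (v : nat -> K * D) :
      mix (pred1 n) (fun=> (k, x)) v = update v n (k, x).
    by apply/funext => y; rewrite /mix /update /=; case: eqP.
  (* Shifting [x] by one turns [i <= j] into [i < j], whence the length [N.+1]; reading both
     sequences backwards turns [j < i] into [i < j]. *)
  case: (split_ladder (idJ k) (T := fun x u => T (update u n (k, x))) N.+1 N (nZ k) sp).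
    move=> [x [v xv]]; apply: (HN (fun i _ => (k, x i.+1)) v) => i j iN jN.
    by rewrite mixE; apply: xv => //; apply: ltnW.
  move=> [x [v xv]].
  apply: (HN (fun i _ => (k, x (N.-1 - i))) (fun j => v (N.-1 - j))) => i j iN jN.
  have N0 : 0 < N by apply: leq_ltn_trans iN.
  have lt_N l : N.-1 - l < N by rewrite (leq_ltn_trans (leq_subr _ _)) // prednK.
  by rewrite mixE xv // ltn_sub2lE // -ltnS prednK.
move=> /choice[Z' Z'P]; exists Z'; split=> [k|k|u]; try by case: (Z'P k).
by have [_ _] := Z'P (u n).1; apply.
Qed.

(* If the two orders disagree, elements chosen alternately on both sides form
   a half graph. *)
Lemma commute_impl Z T a b u : nonsmall Z -> stable_rel T -> a <> b ->
  decides Z T a -> decides Z T b -> decides Z (Q Z b T) a ->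
  Q Z b (Q Z a T) u -> Q Z a (Q Z b T) u.
Proof.
move=> nZ stT ab da db dba QQ; apply: contrapT => /(Q_not nZ dba) nQQ.
have [N HN] := stT (pred1 b).
(* The new [x'] is generic over the earlier [y j], for which [Q Z a T] makes [T] true; the new [y']
   is then generic over all [x2 i], for which [~ Q Z b T] makes [T] false. *)
have ladder n : exists x y, [/\ forall i, i < n -> ~ Q Z b T (put u a (x i)),
    forall i, i < n -> Q Z a T (put u b (y i))
    & forall i j, i < n -> j < n -> T (put (put u a (x i)) b (y j)) <-> j < i].
  elim: n => [|n [x [y [xP yP xyP]]]].
    have [z _] := nonsmall_ex (u a).1 nZ.
    by exists (fun=> z), (fun=> z); split.
  have [|x' Zx' x'P] := @pick_nonsmall Z (u a).1 n.+1 (fun i => if i is j.+1 then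
      exceptions Z a T (put u b (y j)) else
      [set x | Z (u a).1 x /\ ~ ~ Q Z b T (put u a x)]) nZ.
    move=> [//|j] _.
    by have := small_exceptions (put u b (y j)) da; rewrite put_fst.
  pose x2 i := if i < n then x i else x'.
  have x2P i : i < n.+1 -> ~ Q Z b T (put u a (x2 i)).
    rewrite /x2; case: ifP => [/xP //|_ _] QT.
    by apply: (x'P 0) => //; split.
  have [|y' Zy' y'P] := @pick_nonsmall Z (u b).1 n.+2 (fun i => if i is j.+1 then
      exceptions Z b T (put u a (x2 j)) else
      [set y | Z (u b).1 y /\ ~ Q Z a T (put u b y)]) nZ.
    move=> [//|j] _.
    by have := small_exceptions (put u a (x2 j)) db; rewrite put_fst.
  pose y2 i := if i < n then y i else y'.
  exists x2, y2; split=> // [i|i j].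
    rewrite /y2; case: ifP => [/yP //|_ _].
    by apply: contrapT => nQ; apply: (y'P 0).
  rewrite (ltnS j) (leq_eqVlt j) /y2 => iN /predU1P[->|jN].
    rewrite ltnn; split; last by rewrite ltnNge -ltnS iN.
    move=> Txy; case: (x2P i iN); apply: contrapT => nQ.
    by apply: (y'P i.+1) => //; split; [rewrite put_fst|move=> [/(_ Txy)]].
  rewrite jN; move: iN; rewrite (ltnS i) (leq_eqVlt i) /x2 => /predU1P[->|iN].
    rewrite ltnn jN; split=> // _; apply: contrapT => nT.
    apply: (x'P j.+1) => //; split; rewrite ?put_fst // putC; last exact: nesym.
    by move=> [_]; move/(_ (yP j jN)).
  by rewrite iN; apply: xyP.
have [x [y [_ _ xyP]]] := ladder N.
apply: (HN (fun i => put u b (y i)) (fun j => put u a (x j))) => i j iN jN.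
rewrite -(xyP j i jN iN).
suff -> : mix (pred1 b) (put u b (y i)) (put u a (x j)) =
          put (put u a (x j)) b (y i) by [].
apply/funext => z; rewrite /mix /=; have [->|zb] := eqVneq z b.
  by rewrite {1 2}/put !update_same put_fst.
by rewrite {2}/put update_neq //; apply/eqP.
Qed.

(* The variable quantified outermost is the last one of [l]. *)
Fixpoint gen Z (l : seq nat) T : (nat -> K * D) -> Prop :=
  if l is n :: l' then gen Z l' (Q Z n T) else T.

Fixpoint good m k Z T : Prop :=
  if k is k'.+1 then forall n, n < m -> decides Z T n /\ good m k' Z (Q Z n T)
  else True.

Lemma good_sub m k Z Z' T : (forall k, Z' k `<=` Z k) -> nonsmall Z' ->
  good m k Z T -> good m k Z' T.
Proof.
move=> Z'Z nZ'; elim: k T => //= k IHk T gT n /gT[dT gQ].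
by split; [exact: decides_sub dT | rewrite (Q_sub Z'Z nZ' dT); apply: IHk].
Qed.

Lemma good_le m k k' Z T : k' <= k -> good m k Z T -> good m k' Z T.
Proof.
elim: k' k T => [|k' IHk] [|k] T //= kk' gT n /gT[dT gQ].
by split=> //; apply: IHk gQ.
Qed.

(** The conditions are met one after the other; being hereditary, they survive the later
    shrinking. *)
Lemma dense_seq (I : eqType) (P : I -> (K -> set D) -> Prop) (s : seq I) Z :
  (forall i Z1 Z2, i \in s -> (forall k, Z2 k `<=` Z1 k) -> nonsmall Z2 ->
    P i Z1 -> P i Z2) ->
  (forall i Z1, i \in s -> nonsmall Z1 ->
    exists Z2, [/\ forall k, Z2 k `<=` Z1 k, nonsmall Z2 & P i Z2]) ->
  nonsmall Z ->
  exists Z', [/\ forall k, Z' k `<=` Z k, nonsmall Z' & forall i, i \in s -> P i Z'].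
Proof.
move=> hered dense nZ; elim: s hered dense => [|i s IHs] hered dense.
  by exists Z; split=> [k x||i].
have [||Z1 [Z1Z nZ1 PZ1]] := IHs.
- by move=> j Z1 Z2 js; apply: hered; rewrite inE js orbT.
- by move=> j Z1 js; apply: dense; rewrite inE js orbT.
have [|Z2 [Z21 nZ2 PZ2]] := dense i Z1 _ nZ1; first by rewrite mem_head.
exists Z2; split=> // [k|j]; first exact: subset_trans (Z21 k) (Z1Z k).
rewrite inE => /predU1P[->//|js]; apply: (hered j Z1) => //; last exact: PZ1.
by rewrite inE js orbT.
Qed.

Lemma good_exists m k Z T : nonsmall Z -> stable_rel T ->
  exists Z', [/\ forall k, Z' k `<=` Z k, nonsmall Z' & good m k Z' T].
Proof.
elim: k Z T => [|k IHk] Z T nZ stT /=; first by exists Z; split=> [j x||].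
have [|n Z1 _ nZ1|Z' [Z'Z nZ' PZ']] := @dense_seq _
    (fun n Z => decides Z T n /\ good m k Z (Q Z n T)) (iota 0 m) Z _ _ nZ.
- move=> n Z1 Z2 _ Z21 nZ2 [dT gQ]; split; first exact: decides_sub dT.
  by rewrite (Q_sub Z21 nZ2 dT); apply: good_sub gQ.
- have [Z2 [Z21 nZ2 dT]] := decides_exists n nZ1 stT.
  have [Z3 [Z32 nZ3 gQ]] := IHk Z2 _ nZ2 (stable_Q nZ2 dT stT).
  exists Z3; split=> // [j|]; first exact: subset_trans (Z32 j) (Z21 j).
  by split; [apply: decides_sub dT|rewrite (Q_sub Z32 nZ3 dT)].
- by exists Z'; split=> // n nm; apply: PZ'; rewrite mem_iota.
Qed.

Lemma good_exists_fin (I : finType) (R : I -> (nat -> K * D) -> Prop) m k Z :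
  nonsmall Z -> (forall i, stable_rel (R i)) ->
  exists Z', [/\ forall k, Z' k `<=` Z k, nonsmall Z' & forall i, good m k Z' (R i)].
Proof.
move=> nZ stR.
have [|i Z1 _ nZ1|Z' [Z'Z nZ' PZ']] := @dense_seq _
    (fun i Z => good m k Z (R i)) (enum I) Z _ _ nZ.
- by move=> i Z1 Z2 _; apply: good_sub.
- exact: good_exists.
- by exists Z'; split=> // i; apply: PZ'; rewrite mem_enum.
Qed.

Lemma gen_stable m Z l T : nonsmall Z -> good m (size l) Z T ->
  all (fun n => n < m) l -> stable_rel T -> stable_rel (gen Z l T).
Proof.
move=> nZ; elim: l T => //= n l IHl T gT /andP[nm lm] stT.
have [dT gQ] := gT n nm; apply: IHl => //; exact: stable_Q.
Qed.

(** A quantifier erases the value of its variable but keeps the index, which selects the set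
    quantified over. *)
Lemma gen_ext Z l T u u' : (forall i, i \notin l -> u i = u' i) ->
  (forall i, (u i).1 = (u' i).1) -> gen Z l T u = gen Z l T u'.
Proof.
pose inv (s : seq nat) T' := forall v v', (forall i, i \notin s -> v i = v' i) ->
  (forall i, (v i).1 = (v' i).1) -> T' v = T' v'.
suff invgen s : inv s T -> inv (l ++ s) (gen Z l T).
  move=> uu' u1; have inv0 : inv [::] T.
    by move=> v v' vv' _; congr T; apply/funext => i; apply: vv'.
  by have := invgen _ inv0; rewrite cats0; apply.
elim: l s T => //= n l IHl s T invT.
have := IHl (n :: s) (Q Z n T) => H v v' vv'; apply: H => [w w' ww' w1|i].
  rewrite /Q w1; suff TE x : T (put w n x) = T (put w' n x) by under eq_set do rewrite TE.
  apply: invT => i; last by rewrite !put_fst.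
  move=> si; rewrite /put /update w1; case: eqVneq => // ni.
  by apply: ww'; rewrite inE negb_or ni.
by move=> H; apply: vv'; move: H; rewrite inE !mem_cat inE orbCA.
Qed.

Lemma gen_put Z l T n u x : n \in l -> gen Z l T (put u n x) = gen Z l T u.
Proof.
move=> nl; apply: gen_ext => i; last exact: put_fst.
by move=> il; rewrite /put update_neq // => ni; rewrite ni nl in il.
Qed.

(** Neighbouring quantifiers are exchanged until [n] is innermost; [commute_impl], used in both
    directions, makes each exchange an equality. *)
Lemma gen_rem m Z l T n : nonsmall Z -> stable_rel T -> good m (size l) Z T ->
  all (fun i => i < m) l -> n \in l -> gen Z l T = gen Z (n :: rem n l) T.
Proof.
move=> nZ; elim: l T => //= a l IHl T stT gT /andP[am lm].
rewrite inE eq_sym; case: eqVneq => [->//|an] /= nl.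
have [da ga] := gT a am; rewrite (IHl (Q Z a T)) //=; last exact: stable_Q.
congr (gen _ _ _); apply/funext => u.
have nm := allP lm _ nl; have [dn gn] := gT n nm.
have l0 : 0 < size l by case: (l) nl.
have [dan _] := good_le l0 ga n nm; have [dna _] := good_le l0 gn a am.
by apply/propext; split; apply: commute_impl => //; apply/eqP; rewrite // eq_sym.
Qed.
End Quantifiers.

(** * Generic sequences *)

Lemma wf_choice (W D : Type) (d0 : D) (lt : W -> W -> Prop) (P : W -> (W -> D) -> D -> Prop) :
  well_founded lt ->
  (forall w y y', (forall w', lt w' w -> y w' = y' w') -> P w y = P w y') ->
  (forall w y, exists x, P w y x) -> exists y, forall w, P w y (y w).
Proof.
move=> wf Pext Pex.
pose f w y := sval (cid (Pex w y)).
have fP w y : P w y (f w y) by exact: svalP (cid (Pex w y)).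
pose step w (rec : forall w', lt w' w -> D) :=
  (* The recursion provides values below [w] only; [d0] pads them to a function on [W], and [P w]
     does not see the padding. *)
  f w (fun w' => if pselect (lt w' w) is left h then rec w' h else d0).
pose y := Fix wf (fun=> D) step.
have yE w : y w = step w (fun w' _ => y w').
  apply: Fix_eq => w1 g g' gg'; congr (f _ _); apply/funext => w2.
  by case: pselect => //= h; apply: gg'.
exists y => w; rewrite yE /step; set y' := fun w' => _.
rewrite (Pext w y y') // => w' ltw; rewrite /y'; by case: pselect.
Qed.

Lemma seq_max (W : Type) (lt : W -> W -> Prop) (w : nat -> W) (s : seq nat) :
  (forall a b c, lt a b -> lt b c -> lt a c) ->
  (forall i j, i \in s -> j \in s -> i <> j -> lt (w i) (w j) \/ lt (w j) (w i)) ->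
  s != [::] -> exists2 n, n \in s & forall i, i \in s -> i <> n -> lt (w i) (w n).
Proof.
move=> tr; elim: s => //= a s IHs tot _.
have [->|s0] := eqVneq s [::].
  by exists a; rewrite ?mem_head // => i; rewrite inE => /eqP.
have [|n ns nmax] := IHs _ s0.
  by move=> i j si sj; apply: tot; rewrite inE ?si ?sj orbT.
have [an|an] := eqVneq a n.
  exists n; rewrite ?inE ?ns ?orbT // => i; rewrite inE an => /predU1P[->//|]; exact: nmax.
have sn : n \in a :: s by rewrite inE ns orbT.
have [lan|lna] := tot a n (mem_head _ _) sn (elimN eqP an).
  exists n; rewrite ?inE ?ns ?orbT // => i; rewrite inE => /predU1P[->//|]; exact: nmax.
exists a; rewrite ?mem_head // => i; rewrite inE => /predU1P[->//|si ia].
have [->//|/eqP ni] := eqVneq i n.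
exact: tr (nmax _ si ni) lna.
Qed.

Definition supported (V : Type) (m : nat) (T : (nat -> V) -> Prop) : Prop :=
  forall u u', (forall i, i < m -> u i = u' i) -> T u = T u'.

Section Generic.
Variables (K D : Type) (J : K -> set D -> Prop).
Hypothesis idJ : forall k, ideal (J k).
Implicit Types (Z : K -> set D) (T : (nat -> K * D) -> Prop) (u : nat -> K * D).

Lemma supported_Q m Z T n : n < m -> supported m T -> supported m (Q J Z n T).
Proof.
move=> nm sT u u' uu'; rewrite /Q (uu' n nm).
suff TE x : T (put u n x) = T (put u' n x) by under eq_set do rewrite TE.
by apply: sT => i im; rewrite /put /update (uu' n nm); case: eqP => // _; apply: uu'.
Qed.

Lemma supported_gen m Z l T : all (fun n => n < m) l -> supported m T ->
  supported m (gen J Z l T).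
Proof.
elim: l T => //= n l IHl T /andP[nm lm] sT.
by apply: IHl => //; apply: supported_Q.
Qed.

(* [x] is generic of index [c] over the set [B] of values, for [T] and the
   relations obtained from [T] by at most [k] generic quantifications. *)
Fixpoint generic m k Z T (B : set (K * D)) (c : K) (x : D) : Prop :=
  if k is k'.+1 then forall n, n < m ->
    (forall u, (forall i, B (u i)) ->
       T (update u n (c, x)) <-> Q J Z n T (update u n (c, x))) /\
    generic m k' Z (Q J Z n T) B c x
  else True.

Lemma generic_le m k k' Z T B c x : k' <= k ->
  generic m k Z T B c x -> generic m k' Z T B c x.
Proof.
elim: k' k T => [|k' IHk] [|k] T //= kk' gT n /gT[TQ gQ].
by split=> //; apply: IHk gQ.
Qed.

(** A nongeneric value is an exception for some valuation in [B], for [T] or after further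
    quantification. As [B] is few, [few_valuations] collects these exceptions into a small set. *)
Lemma small_nongeneric m k Z T B c : nonsmall J Z -> few (J c) B ->
  supported m T -> good J m k Z T ->
  J c [set x | Z c x /\ ~ generic m k Z T B c x].
Proof.
move=> nZ fB; have [d0 _] := nonsmall_ex idJ c nZ.
elim: k T => [|k IHk] T sT gT.
  by have [_ J0 _] := idJ c; apply: (ideal_sub (idJ c) _ J0) => x [].
(* [d0] is a placeholder: the exceptions at [n] do not depend on the value of [n]. *)
pose bad n := [set x | exists2 u, forall i, B (u i) &
    exceptions J Z n T (update u n (c, d0)) x] `|`
  [set x | Z c x /\ ~ generic m k Z (Q J Z n T) B c x].
have Jbad n : n < m -> J c (bad n).
  move=> nm; have [dT gQ] := gT n nm; apply: (idealU (idJ c)); last first.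
    by apply: IHk => //; apply: supported_Q.
  apply: (few_valuations (m := m) (idJ c)
    (F := fun u => exceptions J Z n T (update u n (c, d0))) fB).
    move=> u u' uu'; rewrite /exceptions.
    have QE : supported m (Q J Z n T) by exact: supported_Q.
    have E y i : i < m -> update u n y i = update u' n y i.
      by rewrite /update; case: eqP => // _; apply: uu'.
    rewrite !update_same (QE _ _ (E (c, d0))).
    suff TE x : T (put (update u n (c, d0)) n x) = T (put (update u' n (c, d0)) n x).
      by under eq_set do rewrite TE.
    by apply: sT => i im; rewrite /put !update_same !updateK; apply: E.
  by move=> u Bu; have := small_exceptions idJ (update u n (c, d0)) dT; rewrite update_same.
apply: (ideal_sub (idJ c) _ (ideal_bigcup_ltn (idJ c) Jbad)) => x [Zx ngx].
apply: contrapT => nbad; apply: ngx => n nm; split=> [u Bu|]; last first.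
  by apply: contrapT => ng; apply: nbad; exists n => //; right.
apply: contrapT => nTQ; apply: nbad; exists n => //; left; exists u => //.
split; first by rewrite update_same.
rewrite /put update_same updateK /= => TQ; apply: nTQ.
have := Q_put J Z n T (update u n (c, d0)) x.
by rewrite /put update_same updateK /= => ->.
Qed.

Variables (W : Type) (lt : W -> W -> Prop) (kk : W -> K) (V0 : set (K * D)).

Definition allowed (y : W -> D) (w : W) : set (K * D) :=
  V0 `|` [set (kk w', y w') | w' in lt ^~ w].

(** Recursion along [lt]: the values ruled out at [w], namely [X w], the earlier values and the
    nongeneric ones for finitely many relations, form a small set, whereas [Z (kk w)] is not
    small. *)
Lemma generic_sequence (d0 : D) (I : finType) (R : I -> (nat -> K * D) -> Prop) m Z
    (X : W -> set D) : well_founded lt -> nonsmall J Z ->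
  (forall i, supported m (R i)) -> (forall i, good J m m Z (R i)) ->
  (forall w, few (J (kk w)) V0) ->
  (forall w, few (J (kk w)) (lt ^~ w)) ->
  (forall k x, J k [set x]) -> (forall w, J (kk w) (X w)) ->
  exists y : W -> D, forall w, [/\ Z (kk w) (y w), ~ X w (y w),
    forall w', lt w' w -> y w' <> y w
    & forall i, generic m m Z (R i) (allowed y w) (kk w) (y w)].
Proof.
move=> wf nZ sR gR fV flt J1 JX.
apply: (wf_choice d0 (P := fun w y x => [/\ Z (kk w) x, ~ X w x,
    forall w', lt w' w -> y w' <> x
    & forall i, generic m m Z (R i) (allowed y w) (kk w) x]) wf).
  move=> w y y' yy'; have -> : allowed y w = allowed y' w.
    congr (_ `|` _); apply/seteqP; split=> _ [w' ltw <-].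
      by exists w' => //; rewrite yy'.
    by exists w' => //; rewrite yy'.
  apply/funext => x; apply/propext; split=> -[Zx Xx yx gx]; split=> // w' ltw.
    by rewrite -yy' //; apply: yx.
  by rewrite yy' //; apply: yx.
move=> w y; apply: contrapT => nox; apply: (nZ (kk w)).
have fA : few (J (kk w)) (allowed y w).
  by apply: few_setU => //; apply: few_image.
have Jg : J (kk w) [set x | exists2 j, j < #|I| & exists2 i : I, enum_rank i = j :> nat &
     Z (kk w) x /\ ~ generic m m Z (R i) (allowed y w) (kk w) x].
  apply: (ideal_bigcup_ltn (idJ _) (F := fun j => [set x | exists2 i : I, enum_rank i = j :> nat &
     Z (kk w) x /\ ~ generic m m Z (R i) (allowed y w) (kk w) x])) => j jI.
  pose i := enum_val (Ordinal jI).
  have := @small_nongeneric m m Z (R i) (allowed y w) (kk w) nZ fA (sR i) (gR i).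
  apply: (ideal_sub (idJ _)) => x [i' i'j [Zx ng]]; split=> //.
  suff -> : i = i' by [].
  by apply: (can_inj enum_rankK); apply: val_inj; rewrite /i enum_valK.
have Jy : J (kk w) (\bigcup_(w' in lt ^~ w) [set y w']).
  by apply: flt => w' _; apply: J1.
apply: (ideal_sub (idJ _) _ (idealU (idJ _) (JX w) (idealU (idJ _) Jy Jg))) => x Zx.
apply: contrapT => /not_orP[nX /not_orP[ny ng]]; apply: nox; exists x; split=> //.
  by move=> w' ltw yx; apply: ny; exists w'.
move=> i; apply: contrapT => ngi; apply: ng; exists (enum_rank i) => //.
by exists i.
Qed.

(** The element at the [lt]-greatest [w n] is generic over all the others, so its variable can be
    quantified first; [gen_rem] brings [n] to the innermost place, and the induction goes on with
    [rem n s]. Thus the order of the [w i] need not match that of [s]. *)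
Lemma generic_truth (W0 : set W) (d0 : D) m Z (y : W -> D) (w : nat -> W) s T u :
  nonsmall J Z -> (forall a b c, lt a b -> lt b c -> lt a c) ->
  (forall a b, W0 a -> W0 b -> a <> b -> lt a b \/ lt b a) ->
  stable_rel T -> good J m (size s) Z T ->
  (forall a, W0 a -> generic m (size s) Z T (allowed y a) (kk a) (y a)) ->
  uniq s -> all (fun i => i < m) s ->
  (forall i, i \in s -> W0 (w i)) ->
  (forall i j, i \in s -> j \in s -> w i = w j -> i = j) ->
  (forall i, i \in s -> V0 (kk (w i), d0)) ->
  (forall i, i \in s -> u i = (kk (w i), y (w i))) ->
  (forall i, i \notin s -> V0 (u i)) ->
  T u <-> gen J Z s T u.
Proof.
move=> nZ tr tot; have [N] := ubnP (size s).
elim: N s T u => // N IHN s T u sN stT gT gen_y us sm sW sinj sV su nsu.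
have [->//|s0] := eqVneq s [::].
have [|n ns nmax] := @seq_max _ lt w s tr _ s0.
  by move=> i j si sj ij; apply: tot; [exact: sW|exact: sW|move/sinj; auto].
have [nm szs] : n < m /\ size s = (size (rem n s)).+1.
  split; first exact: (allP sm).
  by rewrite size_rem // prednK // lt0n size_eq0.
have : good J m (size (rem n s)).+1 Z T by rewrite -szs.
move=> /(_ n nm)[dT gQ].
(* Once quantified, the value at [n] no longer matters; [d0] replaces it and counts as a parameter
   from [V0]. *)
pose u0 := put u n d0.
have u0E : put u0 n (y (w n)) = u.
  by rewrite /u0 putK /put su //= -su // update_id.
have TQ : T u <-> Q J Z n T u.
  have := gen_y _ (sW _ ns); rewrite szs => /(_ n nm)[+ _].
  move=> /(_ u0); have -> : update u0 n (kk (w n), y (w n)) = u.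
    by rewrite -[RHS]u0E /put /u0 put_fst su.
  apply=> i; have [->|/eqP ni] := eqVneq i n.
    by left; rewrite /u0 /put update_same su //=; apply: sV.
  rewrite /u0 /put update_neq //; have [si|] := boolP (i \in s); last by left; apply: nsu.
  by right; exists (w i); [exact: nmax|rewrite su].
rewrite TQ -(Q_put _ _ _ _ _ d0) -/u0.
have -> : gen J Z s T u = gen J Z (rem n s) (Q J Z n T) u0.
  by rewrite -(gen_put J Z T u d0 ns) (gen_rem idJ nZ stT gT sm ns).
have remP i : (i \in rem n s) = (i != n) && (i \in s) by rewrite mem_rem_uniq // inE.
apply: IHN => //.
- by move: sN; rewrite szs.
- exact: stable_Q.
- by move=> a /gen_y; rewrite szs => /(_ n nm)[].
- exact: rem_uniq.
- by apply/allP => i; rewrite remP => /andP[_ /(allP sm)].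
- by move=> i; rewrite remP => /andP[_ /sW].
- by move=> i j; rewrite !remP => /andP[_ si] /andP[_ sj]; apply: sinj.
- by move=> i; rewrite remP => /andP[_ /sV].
- move=> i; rewrite remP => /andP[/eqP ni si].
  by rewrite /u0 /put update_neq // su.
- move=> i; rewrite remP negb_and negbK; have [-> _|/eqP ni /= si] := eqVneq i n.
    by rewrite /u0 /put update_same su //=; apply: sV.
  by rewrite /u0 /put update_neq //; apply: nsu.
Qed.
End Generic.

(** * Ultrapowers *)

Lemma term_bound (L : language) (t : term L) :
  exists m, forall x, term_fv t x -> x < m.
Proof.
elim: t => [x|f args IH] /=; first by exists x.+1 => y ->.
have /choice[m mP] := IH; exists (\max_i m i) => x [i /mP xm].
exact: leq_trans xm (leq_bigmax i).
Qed.

Lemma fv_bound (L : language) (phi : formula L) :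
  exists m, forall x, fv phi x -> x < m.
Proof.
elim: phi => [|s t|r args|psi [m mP] chi [m' m'P]|y psi [m mP]] /=.
- by exists 0.
- have [m mP] := term_bound s; have [m' m'P] := term_bound t.
  exists (maxn m m') => x; rewrite leq_max => -[/mP->//|/m'P->]; exact: orbT.
- have /choice[m mP] := fun i => term_bound (args i).
  exists (\max_i m i) => x [i /mP xm]; exact: leq_trans xm (leq_bigmax i).
- exists (maxn m m') => x; rewrite leq_max => -[/mP->//|/m'P->]; exact: orbT.
- by exists m => x [/mP].
Qed.

Lemma eval_ext (L : language) (M : structure L) (t : term L) (v v' : nat -> M) :
  (forall x, term_fv t x -> v x = v' x) -> eval v t = eval v' t.
Proof.
elim: t => [x|f args IH] /= vv'; first exact: vv'.
by congr finterp; apply/funext => i; apply: IH => x ix; apply: vv'; exists i.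
Qed.

Lemma sat_ext (L : language) (M : structure L) (phi : formula L)
    (v v' : nat -> M) :
  (forall x, fv phi x -> v x = v' x) -> sat v phi = sat v' phi.
Proof.
elim: phi v v' => [//|s t|r args|psi IHpsi chi IHchi|y psi IH] v v' /= vv'.
- by rewrite (@eval_ext _ _ s v v') ?(@eval_ext _ _ t v v') // => x xt;
    apply: vv'; [right|left].
- congr rinterp; apply/funext => i; apply: eval_ext => x ix.
  by apply: vv'; exists i.
- by rewrite (IHpsi v v') ?(IHchi v v') // => x xt; apply: vv'; [right|left].
- have E a : sat (update v y a) psi = sat (update v' y a) psi.
    apply: IH => x xpsi; rewrite /update; case: eqP => // xy.
    by apply: vv'; split.
  by under eq_forall do rewrite E.
Qed.

Section Ultrapower.
Variables (L : language) (M : structure L) (U : set (set nat)).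
Hypothesis uU : UltraFilter U.

Definition ueq (f g : nat -> M) : Prop := U [set n | f n = g n].

Lemma ueq_refl f : ueq f f.
Proof. by apply: filterS filterT => n _. Qed.

Lemma ueq_sym f g : ueq f g -> ueq g f.
Proof. by apply: filterS => n /= ->. Qed.

Lemma ueq_trans g f h : ueq f g -> ueq g h -> ueq f h.
Proof. by move=> fg gh; apply: filterS (filterI fg gh) => n /= [-> ->]. Qed.

(** The quotient as a type of equivalence classes; [urep] chooses representatives, through which the
    symbols are interpreted. *)
Definition upow : Type := {S : set (nat -> M) | exists f, S = ueq f}.

Lemma upow_inj (q q' : upow) : sval q = sval q' -> q = q'.
Proof.
case: q q' => [S HS] [S' HS'] /= SS'; case: _ / SS' in HS' *.
by congr exist; apply: Prop_irrelevance.
Qed.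

Definition ucls (f : nat -> M) : upow := exist _ (ueq f) (ex_intro _ f erefl).

Definition urep (q : upow) : nat -> M := sval (cid (svalP q)).

Lemma uclsE f g : ueq f g -> ucls f = ucls g.
Proof.
move=> fg; have E : ueq f = ueq g.
  apply/funext => h; apply/propext; split; apply: ueq_trans => //.
  exact: ueq_sym.
exact: upow_inj.
Qed.

Lemma ucls_inj f g : ucls f = ucls g -> ueq f g.
Proof. by case=> ->; apply: ueq_refl. Qed.

Lemma urepK : cancel urep ucls.
Proof.
move=> q; apply: upow_inj; rewrite /urep /=.
by case: (cid _) => f /= ->.
Qed.

Lemma uclsK f : ueq (urep (ucls f)) f.
Proof. by apply: ucls_inj; rewrite urepK. Qed.

Lemma upow_inhabited : inhabited upow.
Proof. by have [a] := dom_inhabited M; exists; exact: ucls (fun=> a). Qed.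

Definition ultrapower : structure L := @Structure L upow upow_inhabited
  (fun f args => ucls (fun n => finterp (fun i => urep (args i) n)))
  (fun r args => U [set n | rinterp (fun i => urep (args i) n)]).

Lemma eval_ultrapower (v : nat -> ultrapower) (t : term L) :
  ueq (urep (eval v t)) (fun n => eval (fun x => urep (v x) n) t).
Proof.
elim: t => [x|f args IH] /=; first exact: ueq_refl.
apply: ueq_trans (uclsK _) _.
apply: filterS (filter_forall _ IH) => n /= nE.
by congr finterp; apply/funext.
Qed.

(** Los's theorem. The universal case chooses a counterexample at every coordinate that has one; the
    class of these choices refutes the left side. *)
Lemma los (phi : formula L) (v : nat -> ultrapower) :
  sat v phi <-> U [set n | sat (fun x => urep (v x) n) phi].
Proof.
elim: phi v => [|s t|r args|psi IHpsi chi IHchi|y psi IH] v /=.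
- by split=> // U0; case: (filter_not_empty U); apply: filterS U0.
- have es := eval_ultrapower v s; have et := eval_ultrapower v t; split=> [st|st].
    by apply: filterS2 es et => n /=; rewrite st => <- <-.
  rewrite -(urepK (eval v s)) -(urepK (eval v t)); apply: uclsE.
  exact: ueq_trans es (ueq_trans st (ueq_sym et)).
- have E : U [set n | forall i, urep (eval v (args i)) n =
                     eval (fun x => urep (v x) n) (args i)].
    by apply: filter_forall => i; apply: eval_ultrapower.
  split=> Ur; apply: filterS2 E Ur => n /= E; suff -> :
    (fun i => eval (fun x => urep (v x) n) (args i)) =
    (fun i => urep (eval v (args i)) n) by [].
  + by apply/funext => i; rewrite E.
  + by apply/funext => i; rewrite E.
- rewrite IHpsi IHchi; split=> [imp|Uimp Upsi]; last first.
    by apply: filterS2 Uimp Upsi => n /=; apply.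
  have [Upsi|Unpsi] := in_ultra_setVsetC
      [set n | sat (fun x => urep (v x) n) psi] uU.
    by apply: filterS (imp Upsi) => n /= chi_n _.
  by apply: filterS Unpsi => n /= npsi /npsi.
- have updE a n : (fun x => urep (update v y a x) n) =
      update (fun x => urep (v x) n) y (urep a n).
    by apply/funext => x; rewrite /update; case: eqP.
  split=> [all|Uall a]; last first.
    by rewrite IH; apply: filterS Uall => n /=; rewrite updE; apply.
  have [//|Un] := in_ultra_setVsetC
    [set n | forall a, sat (update (fun x => urep (v x) n) y a) psi] uU.
  have [a0] := dom_inhabited M.
  have : forall n, exists a, (exists b, ~ sat (update (fun x => urep (v x) n) y b) psi) ->
      ~ sat (update (fun x => urep (v x) n) y a) psi.
    move=> n; have [[b nb]|nob] :=
      pselect (exists b, ~ sat (update (fun x => urep (v x) n) y b) psi).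
      by exists b.
    by exists a0.
  move=> /choice[f fP]; have := all (ucls f); rewrite IH => Uf.
  have Uff := uclsK f.
  exfalso; apply: (filter_not_empty U).
  apply: filterS (filterI Un (filterI Uf Uff)) => n /= [nall [sf ff]].
  move: sf; rewrite updE ff; apply: fP.
  by apply: contrapT => nob; apply: nall => b; apply: contrapT => nb; apply: nob; exists b.
Qed.

End Ultrapower.

(** Arbitrarily long half graphs in [M] would combine coordinatewise into an infinite one in an
    ultrapower, which is a model of [T] by [los]. *)
Lemma stable_sat (L : language) (T : set (formula L)) (M : structure L)
    (phi : formula L) : stable T -> models M T ->
  stable_rel (fun v : nat -> M => sat v phi).
Proof.
move=> stT MT p; apply: contrapT => nobound; apply: (stT phi).
have : forall N, exists ab : (nat -> nat -> M) * (nat -> nat -> M),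
    half_graph (fun v : nat -> M => sat v phi) p N ab.1 ab.2.
  move=> N; apply: contrapT => noab; apply: nobound; exists N => a b hg.
  by apply: noab; exists (a, b).
move=> /choice[ab abP].
(* [U] extends the filter of tails, so almost every [n] exceeds any given [i] and [j]. *)
have [U [uU evU]] := ultraFilterLemma eventually_filter.
exists (ultrapower M U), p, (fun i x => ucls U (fun n => (ab n).1 i x)),
  (fun j x => ucls U (fun n => (ab n).2 j x)); split.
  by move=> psi Tpsi v; rewrite los; apply: filterS filterT => n _; apply: MT.
move=> i j; rewrite los.
have [m mP] := fv_bound phi.
(* Representatives agree with the given sequences only almost everywhere; finitely many variables
   can share one set in [U]. *)
have Ur : U [set n | forall x : 'I_m,
    urep (if p x then ucls U (fun n => (ab n).1 i x)
          else ucls U (fun n => (ab n).2 j x)) n = mix p ((ab n).1 i) ((ab n).2 j) x].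
  by apply: filter_forall => x; rewrite /mix; case: ifP => _; exact: uclsK.
have Uev : U [set n | (maxn i j).+1 <= n].
  by apply: evU; exists (maxn i j).+1.
have Us : U [set n | sat (fun x => urep (if p x then ucls U (fun n => (ab n).1 i x)
          else ucls U (fun n => (ab n).2 j x)) n) phi <-> i < j].
  apply: filterS2 Ur Uev => n /= rE; rewrite gtn_max => /andP[iN jN].
  rewrite -(abP n i j iN jN); rewrite (@sat_ext _ _ _ _ (mix p ((ab n).1 i) ((ab n).2 j))) //.
  by move=> x /mP xm; rewrite (rE (Ordinal xm)).
split=> [Usat|ij].
  have [n [nE /nE]] := filter_ex (filterI Us Usat) => //.
by apply: filterS Us => n /= ->.
Qed.

(** * Uniform sequences along a cofinal set *)

Section WellOrder.
Variables (K : Type) (le : rel K).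
Hypothesis wo : well_order le.

Lemma wo_min (A : set K) : A !=set0 -> exists2 m, A m & forall x, A x -> le m x.
Proof.
move=> [a Aa]; have [|m [[mA mmin] _]] := wo (A := [pred x | `[< A x >]]).
  by exists a; apply/asboolP.
exists m => [|x Ax]; first by apply/asboolP.
by apply: mmin; apply/asboolP.
Qed.

Lemma wo_refl x : le x x.
Proof.
by have [m -> mx] := @wo_min [set x] (ex_intro _ x erefl); apply: mx.
Qed.

Lemma wo_total x y : le x y \/ le y x.
Proof.
have [|m mxy mmin] := @wo_min [set x; y]; first by exists x; left.
by case: mxy => <-; [left|right]; apply: mmin; [right|left].
Qed.

Lemma wo_anti x y : le x y -> le y x -> x = y.
Proof.
move=> xy yx; have [|m [_ muniq]] := wo (A := [pred z | `[< z = x \/ z = y >]]).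
  by exists x; apply/asboolP; left.
rewrite -(muniq x); last first.
  split=> [|z]; first by apply/asboolP; left.
  by move=> /asboolP[->|->//]; apply: wo_refl.
apply: muniq; split=> [|z]; first by apply/asboolP; right.
by move=> /asboolP[->//|->]; apply: wo_refl.
Qed.

Lemma wo_trans y x z : le x y -> le y z -> le x z.
Proof.
move=> xy yz; have [|m [[->|->]|->] mmin] := @wo_min [set x; y; z].
- by exists x; left; left.
- by apply: mmin; right.
- by have -> : x = y by apply: wo_anti => //; apply: mmin; left; left.
- by have <- : y = z by apply: wo_anti => //; apply: mmin; left; right.
Qed.

Definition slt x y : Prop := le x y /\ x <> y.

Lemma slt_trans y x z : slt x y -> slt y z -> slt x z.
Proof.
move=> [xy nxy] [yz nyz]; split=> [|xz]; first exact: wo_trans yz.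
by apply: nyz; apply: wo_anti => //; rewrite -xz.
Qed.

Lemma slt_le_trans y x z : slt x y -> le y z -> slt x z.
Proof.
move=> [xy nxy] yz; split=> [|xz]; first exact: wo_trans yz.
by apply: nxy; apply: wo_anti => //; rewrite xz.
Qed.

Lemma slt_le_false x y : slt x y -> ~ le y x.
Proof. by move=> [xy nxy] yx; apply: nxy; apply: wo_anti. Qed.

Lemma slt_total x y : x <> y -> slt x y \/ slt y x.
Proof.
by move=> xy; case: (wo_total x y) => h; [left|right]; split=> //; apply: nesym.
Qed.

Lemma slt_wf : well_founded slt.
Proof.
move=> x; apply: contrapT => nAx.
have [m nAm mmin] := @wo_min [set y | ~ Acc slt y] (ex_intro _ x nAx).
apply: nAm; constructor => y ym; apply: contrapT => nAy.
exact: slt_le_false ym (mmin _ nAy).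
Qed.

End WellOrder.

Section Cofinality.
Variables (K : Type) (le : rel K).
Hypothesis cardK : is_cardinal le.
Hypothesis Kinf : infinite_set [set: K].
Variables (C : set K).
Hypothesis cofC : attains_cof le C.

Let wo : well_order le := cardK.1.

Lemma card_le_segment x : ~ ([set: K] #<= [set y | slt le y x]).
Proof. by have [_ /(_ x)[]] := cardK. Qed.

(** Below a greatest element there would be a proper initial segment of full size, as one point adds
    nothing to an infinite set. *)
Lemma cardinal_nomax x : exists y, slt le x y.
Proof.
apply: contrapT => nomax; apply: (@card_le_segment x).
have segK : [set: K] = [set y | slt le y x] `|` [set x].
  apply/seteqP; split=> // y _; have [->|yx] := pselect (y = x); first by right.
  by left; case: (slt_total wo yx) => // xy; case: nomax; exists y.
have seginf : infinite_set [set y | slt le y x].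
  by move=> segfin; apply: Kinf; rewrite segK finite_setU; split.
rewrite {1}segK; apply: card_setU_le => //; first exact: card_infiniteX.
by apply: card_le_trans ((infiniteP _).1 seginf); apply: countable1.
Qed.

Lemma cof_infinite : infinite_set C.
Proof.
move=> [n /card_eqPle[Cn _]]; have [cof _] := cofC.
have [x _] := infinite_setN0 Kinf; have [c Cc _] := cof x.
have [g gC gs] := surj_of_card_le Cn (ex_intro _ c Cc).
have [b bP] : exists b, forall i, i < n -> le (g i) b.
  elim: (n) => [|k [b bP]]; first by exists x.
  case: (wo_total wo b (g k)) => h.
    exists (g k) => i; rewrite ltnS leq_eqVlt => /predU1P[->|/bP ib].
      exact: wo_refl.
    exact: wo_trans ib h.
  by exists b => i; rewrite ltnS leq_eqVlt => /predU1P[->//|/bP].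
have [b' bb'] := cardinal_nomax b.
have [c' /gs[i ni <-] b'i] := cof b'.
by apply: (slt_le_false wo bb'); apply: wo_trans (bP i ni).
Qed.

(** If the union were cofinal, chosen bounds of the sets [F b] would form a cofinal set no larger
    than [B], and minimality of [C] would give [C #<= B]. *)
Lemma few_noncofinal (D I : Type) (f : D -> K) (B : set I) : ~ (C #<= B) ->
  few (fun S : set D => ~ cofinal le (f @` S)) B.
Proof.
move=> CB F ncF.
have : forall b, exists x, B b -> forall d, F b d -> ~ le x (f d).
  move=> b; have [Bb|] := pselect (B b); last first.
    by have [x _] := infinite_setN0 Kinf; exists x.
  have /existsNP[x nx] := ncF b Bb; exists x => _ d Fd xd; apply: nx.
  by exists (f d) => //; exists d.
move=> /choice[g gP] cofU; apply: CB.
apply: card_le_trans (card_image_le g B); apply: cofC.2.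
move=> x; have [_ [d [b Bb Fd] <-] xd] := cofU x; exists (g b); first by exists b.
have [//|bg] := wo_total wo x (g b).
by case: (gP b Bb d Fd); apply: wo_trans xd.
Qed.

Lemma ideal_noncofinal (D : Type) (f : D -> K) :
  ideal (fun S : set D => ~ cofinal le (f @` S)).
Proof.
split.
- move=> S S' SS' ncS' cS; apply: ncS' => x; have [_ [d Sd <-] xd] := cS x.
  by exists (f d) => //; exists d => //; apply: SS'.
- by have [x _] := infinite_setN0 Kinf; move=> /(_ x)[y [d []]].
- apply: few_noncofinal => Cb; apply: cof_infinite.
  exact: card_le_finite Cb finite_finset.
Qed.

(* A well-ordered index set of order type the cardinal [|C|]: either [C] itself
   or its shortest initial segment that still has size [|C|]. *)
Lemma cof_index : exists (W0 : set K) (g : K -> K),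
  [/\ forall x, C x -> exists2 w, W0 w & g w = x
    & forall w, ~ (C #<= [set w' | [/\ W0 w', W0 w & slt le w' w]])].
Proof.
have [[x Cx]|noC] := pselect (exists x, C #<= [set y | C y /\ slt le y x]); last first.
  exists C, id; split=> [y Cy|w Cw]; first by exists y.
  apply: noC; exists w; apply: card_le_trans Cw _.
  by apply: subset_card_le => y [].
have [m Cm mmin] := @wo_min _ _ wo [set x | C #<= [set y | C y /\ slt le y x]]
  (ex_intro _ x Cx).
have [g _ gs] := surj_of_card_le Cm (infinite_setN0 cof_infinite).
exists [set y | C y /\ slt le y m], g; split=> // w Cw.
have [[Cw' wm]|nw] := pselect (C w /\ slt le w m).
  apply: (slt_le_false wo wm); apply: mmin; apply: card_le_trans Cw _.
  by apply: subset_card_le => y [[]].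
apply: cof_infinite; apply: card_le_finite Cw _.
suff -> : [set w' | [/\ C w' /\ slt le w' m, C w /\ slt le w m & slt le w' w]] = set0.
  exact: finite_set0.
by apply/seteqP; split=> // y [].
Qed.

(** A generic sequence of indices is built for the single ideal of noncofinal sets, so the index
    type is [unit]. Quantifying all variables in [s] erases the chosen indices, so any two injective
    choices from the sequence give the same truth value. *)
Lemma uniform_indices (D : Type) (d0 : D) (c0 : K) (B : set D) (I : finType)
    (G : I -> (nat -> K * D) -> Prop) m :
  B d0 -> ~ (C #<= B) -> (forall i, stable_rel (G i)) ->
  (forall i, supported m (G i)) ->
  exists I0 : set K, [/\ I0 `<=` C, cofinal le I0 &
    forall i s (f f' : nat -> K) (p : nat -> D),
    uniq s -> all (fun j => j < m) s -> (forall j, B (p j)) ->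
    (forall j, j \in s -> I0 (f j) /\ I0 (f' j)) ->
    (forall j j', j \in s -> j' \in s -> f j = f j' -> j = j') ->
    (forall j j', j \in s -> j' \in s -> f' j = f' j' -> j = j') ->
    G i (fun j => if j \in s then (f j, d0) else (c0, p j)) <->
    G i (fun j => if j \in s then (f' j, d0) else (c0, p j))].
Proof.
move=> Bd0 CB stG sG; have [W0 [g [gs W0few]]] := cof_index.
pose J (_ : unit) (S : set (K * D)) := ~ cofinal le (fst @` S).
pose idJ (k : unit) : ideal (J k) := ideal_noncofinal fst.
pose T i (v : nat -> unit * (K * D)) := G i (snd \o v).
have stT i : stable_rel (T i) by apply: stable_map.
have sT i : supported m (T i).
  by move=> u u' uu'; apply: sG => j jm; rewrite /= uu'.
pose Z0 (_ : unit) : set (K * D) := (fun c => (c, d0)) @` C.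
have nZ0 : nonsmall J Z0.
  move=> k; apply=> x; have [c Cc xc] := cofC.1 x.
  by exists c => //; exists (c, d0) => //; exists c.
have [Z [ZZ0 nZ gZ]] := good_exists_fin idJ m m nZ0 stT.
pose lt w' w := [/\ W0 w', W0 w & slt le w' w].
have ltwf : well_founded lt.
  move=> w; elim/(well_founded_ind (slt_wf wo)): w => w IH.
  by constructor => w' [_ _ /IH].
pose Vp : set (unit * (K * D)) := (fun a => (tt, (c0, a))) @` B.
(* [X w] excludes the indices not above [g w], which makes the sequence cofinal. *)
have [||||y yP] := generic_sequence (kk := fun=> tt) (V0 := Vp)
   idJ (c0, d0) (X := fun w => [set q | ~ le (g w) q.1]) ltwf nZ sT gZ.
- by move=> w; apply: (few_image (idJ tt)); apply: (few_noncofinal (f := fst) CB).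
- by move=> w; apply: (few_noncofinal (f := fst) (W0few w)).
- move=> k [x d] cx; have [x' xx'] := cardinal_nomax x.
  by have [_ [_ -> <-]] := cx x'; apply: (slt_le_false wo xx').
- move=> w cX; have [x gx] := cardinal_nomax (g w).
  have [_ [q /= nq <-] xq] := cX x; apply: nq; apply: wo_trans xq => //.
  by case: gx.
have yE w : exists2 c, C c & y w = (c, d0).
  by have [/ZZ0[c Cc <-] _ _ _] := yP w; exists c.
have ltot a b : W0 a -> W0 b -> a <> b -> lt a b \/ lt b a.
  by move=> Wa Wb /(slt_total wo)[]; [left|right].
have ltr a b c : lt a b -> lt b c -> lt a c.
  by move=> [Wa Wb ab] [_ Wc bc]; split=> //; apply: slt_trans bc.
exists [set (y w).1 | w in W0]; split.
- by move=> _ [w _ <-]; have [c Cc ->] := yE w.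
- move=> x; have [c /gs[w W0w gw] xc] := cofC.1 x.
  exists (y w).1; first by exists w.
  have [_ nX _ _] := yP w; apply: wo_trans xc _ => //.
  by rewrite -gw; apply: contrapT.
move=> i s f f' p us sm Bp If injf injf'.
pose U (h : nat -> K) (j : nat) := (tt, if j \in s then (h j, d0) else (c0, p j)).
have gen_U h : (forall j, j \in s -> [set (y w).1 | w in W0] (h j)) ->
    (forall j j', j \in s -> j' \in s -> h j = h j' -> j = j') ->
    T i (U h) <-> gen J Z s (T i) (U h).
  move=> Ih injh.
  have : forall j, exists w, j \in s -> W0 w /\ (y w).1 = h j.
    move=> j; have [js|] := boolP (j \in s); last by exists c0.
    by have [w W0w yw] := Ih j js; exists w.
  move=> /choice[w wP].
  have szs : size s <= m.
    by rewrite -(size_iota 0 m) uniq_leq_size // => j /(allP sm); rewrite mem_iota.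
  apply: (generic_truth idJ (lt := lt) (kk := fun=> tt) (V0 := Vp) (W0 := W0)
    (d0 := (c0, d0)) (m := m) (y := y) (w := w)) => //.
  - exact: good_le (gZ i).
  - by move=> a W0a; have [_ _ _ /(_ i)] := yP a; apply: generic_le.
  - by move=> j js; have [] := wP j js.
  - move=> j j' js j's ww; apply: injh => //.
    by have [_ <-] := wP j js; have [_ <-] := wP j' j's; rewrite ww.
  - by move=> j js; exists d0.
  - move=> j js; rewrite /U js; have [_ <-] := wP j js.
    by have [c _ ->] := yE (w j).
  - by move=> j /negbTE js; rewrite /U js; exists (p j).
have E h : G i (fun j => if j \in s then (h j, d0) else (c0, p j)) = T i (U h) by [].
rewrite !E !gen_U // => [|j /If[]|j /If[]//]; last by [].
suff -> : gen J Z s (T i) (U f) = gen J Z s (T i) (U f') by [].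
apply: gen_ext => j; last by [].
by move=> /negbTE js; rewrite /U js.
Qed.

Hypothesis KC : ~ ([set: K] #<= C).

(** Here singularity enters: otherwise [K] would be a union over [C] of segments no larger than [C],
    hence itself no larger than [C]. *)
Lemma cof_small_segment : exists c, C #<= [set y | slt le y c].
Proof.
apply: contrapT => noc; apply: KC.
apply: (@card_le_trans _ _ _ (\bigcup_(c in C) [set y | slt le y c])).
  apply: subset_card_le => y _; have [y' yy'] := cardinal_nomax y.
  have [c Cc y'c] := cofC.1 y'; exists c => //=; exact: slt_le_trans yy' y'c.
apply: card_bigcup_le => [||c Cc]; [exact: cof_infinite|exact: card_lexx|].
by case: (card_le_total C [set y | slt le y c]) => // Cs; case: noc; exists c.
Qed.

(** Elements are named by an index from a cofinal set and a position. Genericity turns a relation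
    between elements into a quantified relation between their indices, whose truth depends only on
    the equality pattern by [uniform_indices]. *)
Theorem uniform_sequence (D : Type) (d0 : D) (B X : set D) (I : finType)
    (R : I -> (nat -> D) -> Prop) (L : I -> seq nat) m :
  B d0 -> ~ (C #<= B) -> [set: K] #<= X ->
  (forall i, stable_rel (R i)) -> (forall i, supported m (R i)) ->
  (forall i, uniq (L i)) -> (forall i, all (fun j => j < m) (L i)) ->
  exists (W : set (K * K)) (y : K * K -> D),
  [/\ forall w, W w -> X (y w),
      forall w w', W w -> W w' -> y w = y w' -> w = w',
      [set: K] #<= W,
      infinite_set (fst @` W) /\
      forall w, W w -> infinite_set [set w' | W w' /\ w'.1 = w.1]
    & forall i (w w' : nat -> K * K) (p : nat -> D),
      (forall j, j \in L i -> W (w j) /\ W (w' j)) ->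
      (forall j j', j \in L i -> j' \in L i -> w j = w j' -> j = j') ->
      (forall j j', j \in L i -> j' \in L i -> w' j = w' j' -> j = j') ->
      (forall j j', j \in L i -> j' \in L i ->
        (w j).1 = (w j').1 <-> (w' j).1 = (w' j').1) ->
      (forall j, B (p j)) ->
      R i (fun j => if j \in L i then y (w j) else p j) <->
      R i (fun j => if j \in L i then y (w' j) else p j)].
Proof.
move=> Bd0 CB KX stR sR uL mL.
have [c1 Cc1] := cof_small_segment.
have [c0 Cc0] := infinite_setN0 cof_infinite.
(* The segment below [c1] is added so that every [seg k] is at least as large as [C]; parameters and
   indices are then few for each ideal. *)
pose seg k := [set x | slt le x k \/ slt le x c1].
have Cseg k : C #<= seg k.
  by apply: card_le_trans Cc1 _; apply: subset_card_le => x; right.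
have seginf k : infinite_set (seg k).
  by move=> /(card_le_finite (Cseg k)); apply: cof_infinite.
have segK k : ~ ([set: K] #<= seg k).
  case: (wo_total wo k c1) => kc Kseg; [apply: (@card_le_segment c1)|apply: (@card_le_segment k)];
    apply: card_le_trans Kseg _; apply: subset_card_le => x [] //= xk.
    exact: slt_le_trans xk kc.
  exact: slt_le_trans xk kc.
have countable_seg (U : Type) (S : set U) k : countable S -> S #<= seg k.
  by move=> cS; apply: card_le_trans cS _; apply/infiniteP.
pose J k (S : set D) := S #<= seg k.
have few_seg (U : Type) k (S : set U) : S #<= seg k -> few (J k) S.
  by move=> Sk F JF; apply: card_bigcup_le.
have idJ k : ideal (J k).
  split; first by move=> S S' SS'; apply: card_le_trans; apply: subset_card_le.
    exact: card_ge0.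
  by apply: few_seg; apply: countable_seg; apply: finite_set_countable; apply: finite_finset.
have J1 k x : J k [set x] by apply: countable_seg; apply: countable1.
pose T i (u : nat -> K * D) := R i (snd \o u).
have stT i : stable_rel (T i) by apply: stable_map.
have sT i : supported m (T i).
  by move=> u u' uu'; apply: sR => j jm; rewrite /= uu'.
have nX : nonsmall J (fun=> X) by move=> k /(card_le_trans KX)/segK.
have [Z [ZX nZ gZ]] := good_exists_fin idJ m m nX stT.
have szL i : size (L i) <= m.
  by rewrite -(size_iota 0 m) uniq_leq_size // => j /(allP (mL i)); rewrite mem_iota.
pose G i := gen J Z (L i) (T i).
have stG i : stable_rel (G i).
  by apply: gen_stable (stT i) => //; apply: good_le (gZ i).
have sG i : supported m (G i) by apply: supported_gen.
(* Variables may share an index, while [uniform_indices] asks for distinct ones; so all renamings of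
   variables are included in the finite family of relations. *)
pose pm (pi : {ffun 'I_m -> 'I_m}) (j : nat) : nat :=
  if insub j is Some o then pi o else j.
have pm_lt pi j : j < m -> pm pi j < m by move=> jm; rewrite /pm insubT.
have [I0 [I0C cofI0 unif]] := @uniform_indices D d0 c0 B
  (I * {ffun 'I_m -> 'I_m})%type (fun q u => G q.1 (u \o pm q.2)) m Bd0 CB
  (fun q => stable_rename (pm q.2) (stG q.1))
  (fun q u u' uu' => sG q.1 _ _ (fun j jm => uu' _ (pm_lt q.2 j jm))).
pose W : set (K * K) := [set w | I0 w.1 /\ seg w.1 w.2].
pose lt w' w := [/\ W w', W w &
  slt le w'.1 w.1 \/ w'.1 = w.1 /\ slt le w'.2 w.2].
have ltwf : well_founded lt.
  move=> [a b]; elim/(well_founded_ind (slt_wf wo)): a b => a IHa b.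
  elim/(well_founded_ind (slt_wf wo)): b => b IHb.
  constructor => -[a' b'] [_ _ /= [/IHa//|[-> /IHb//]]].
have ltot a b : W a -> W b -> a <> b -> lt a b \/ lt b a.
  case: a b => [a1 a2] [b1 b2] Wa Wb ab.
  have [ab1|/(slt_total wo)[]] := pselect (a1 = b1); last 2 first.
  - by left; split=> //; left.
  - by right; split=> //; left.
  have [ab2|/(slt_total wo)[]] := pselect (a2 = b2).
  - by case: ab; rewrite ab1 ab2.
  - by left; split=> //; right.
  - by right; split=> //; right.
have ltr a b c : lt a b -> lt b c -> lt a c.
  move=> [Wa Wb ab] [_ Wc bc]; split=> //.
  case: ab bc => [ab|[-> ab]] [bc|[bc1 bc]].
  - by left; apply: slt_trans bc.
  - by left; rewrite -bc1.
  - by left.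
  - by right; split=> //; apply: slt_trans bc.
pose V0 : set (K * D) := C `*` B.
have BC : B #<= C by case: (card_le_total C B).
have fV k : few (J k) V0.
  by apply: (few_setX (idJ k)); apply: few_seg => //; apply: card_le_trans BC _.
(* The predecessors of [w] have their index in [C] and their position in [seg w.1]. *)
have flt w : few (J w.1) (lt ^~ w).
  apply: (few_sub (idJ w.1) (B' := C `*` seg w.1)).
    move=> [a b] [[/= I0a segab] _ ab]; split=> /=; first exact: I0C.
    case: segab => [ba|]; last by right.
    by left; case: ab => [aw|[<-//]]; apply: slt_trans aw.
  by apply: (few_setX (idJ _)); apply: few_seg => //; apply: card_lexx.
have [y yP] := generic_sequence (kk := fst) (V0 := V0) idJ d0 (X := fun=> set0)
  ltwf nZ sT gZ (fun w => fV w.1) flt J1 (fun w => card_ge0 D (seg w.1)).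
(* Elements are replaced by their indices: [G i] ignores the values at [L i], so [d0] can fill
   them. *)
have key i (w : nat -> K * K) p : (forall j, j \in L i -> W (w j)) ->
    (forall j j', j \in L i -> j' \in L i -> w j = w j' -> j = j') ->
    (forall j, B (p j)) ->
    R i (fun j => if j \in L i then y (w j) else p j) <->
    G i (fun j => if j \in L i then ((w j).1, d0) else (c0, p j)).
  move=> Ww winj Bp.
  pose u j := if j \in L i then ((w j).1, y (w j)) else (c0, p j).
  have -> : R i (fun j => if j \in L i then y (w j) else p j) = T i u.
    by congr (R i _); apply/funext => j; rewrite /u /=; case: ifP.
  have -> : G i (fun j => if j \in L i then ((w j).1, d0) else (c0, p j)) = G i u.
    by apply: gen_ext => j; rewrite /u; case: ifP.
  apply: (generic_truth idJ (lt := lt) (kk := fst) (V0 := V0) (W0 := W)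
    (d0 := d0) (m := m) (y := y) (w := w)) => //.
  - exact: good_le (gZ i).
  - by move=> a Wa; have [_ _ _ /(_ i)] := yP a; apply: generic_le.
  - by move=> j /Ww[/I0C ? _]; split.
  - by move=> j js; rewrite /u js.
  - by move=> j /negbTE js; rewrite /u js; split=> //=; apply: Bp.
exists W, y; split.
- by move=> w _; have [/ZX] := yP w.
- move=> w w' Ww Ww' yy; apply: contrapT => /(ltot _ _ Ww Ww')[] h.
    by have [_ _ /(_ _ h)] := yP w'.
  by have [_ _ /(_ _ h)] := yP w; rewrite yy.
(* An index [c b] above [b] admits [b] as a position, which injects [K] into [W]. *)
- have : forall b, exists c, I0 c /\ slt le b c.
    move=> b; have [b' bb'] := cardinal_nomax b; have [c I0c b'c] := cofI0 b'.
    by exists c; split=> //; apply: slt_le_trans b'c.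
  move=> /choice[c cP]; apply: (@card_le_of_inj _ _ _ _ (fun b => (c b, b))).
    by move=> b _; have [I0c bc] := cP b; split=> //; left.
  by move=> b b' _ _ [].
- split=> [|w [I0w _]].
    move=> fin; apply: cof_infinite; apply: card_le_finite (cofC.2 _ cofI0) _.
    apply: sub_finite_set fin => c I0c; have [b segb] := infinite_setN0 (seginf c).
    by exists (c, b).
  move=> fin; apply: (seginf w.1); apply: card_le_finite fin.
  by apply: (@card_le_of_inj _ _ _ _ (fun b => (w.1, b))) => [b sb|b b' _ _ []].
move=> i w w' p Ww winj w'inj ww' Bp.
rewrite !key //; try by move=> j /Ww[].
(* [pi j] is the first variable of [L i] sharing the index of [j]; it serves [w'] as well because
   the equality patterns agree. *)
pose pi j := if j \in L i then
  find (fun j' => (j' \in L i) && `[< (w j').1 = (w j).1 >]) (iota 0 m) else j.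
have piP j : j \in L i -> [/\ pi j \in L i, (w (pi j)).1 = (w j).1 & pi j < m].
  move=> js; rewrite /pi js; set a := fun j' => _.
  have jm : j < m by exact: (allP (mL i)).
  have ha : has a (iota 0 m).
    by apply/hasP; exists j; rewrite ?mem_iota // /a js; apply/asboolP.
  have fm : find a (iota 0 m) < m by rewrite -{2}(size_iota 0 m) -has_find.
  have := nth_find 0 ha; rewrite nth_iota // add0n => /andP[-> /asboolP ->].
  by split.
have pi_eq j j' : j \in L i -> j' \in L i -> (w j).1 = (w j').1 -> pi j = pi j'.
  by move=> js js' E; rewrite /pi js js' E.
pose s := [seq j <- L i | pi j == j].
have collapse (f : nat -> K) : (forall j, j \in L i -> f (pi j) = f j) ->
    G i (fun j => if j \in L i then (f j, d0) else (c0, p j)) =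
    G i ((fun j => if j \in s then (f j, d0) else (c0, p j)) \o
         pm [ffun o : 'I_m => insubd o (pi o)]).
  move=> fpi; apply: sG => j jm /=; rewrite /pm insubT ffunE val_insubd /= mem_filter.
  have [js|js] := boolP (j \in L i); last by rewrite /pi (negbTE js) jm (negbTE js) andbF.
  have [pis wpi pim] := piP j js.
  by rewrite pim pis (pi_eq _ _ pis js wpi) eqxx /= fpi.
rewrite !collapse; last 2 first.
- by move=> j js; have [pis /(ww' _ _ pis js) E _] := piP j js.
- by move=> j js; have [] := piP j js.
have sL j : j \in s -> pi j = j /\ j \in L i by rewrite mem_filter => /andP[/eqP].
apply: (unif (i, [ffun o : 'I_m => insubd o (pi o)]) s) => //.
- exact: filter_uniq.
- by apply/allP => j /sL[_]; apply: (allP (mL i)).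
- by move=> j /sL[_ /Ww[[I0w _] [I0w' _]]].
- by move=> j j' /sL[pj js] /sL[pj' js'] E; rewrite -pj -pj'; apply: pi_eq.
- by move=> j j' /sL[pj js] /sL[pj' js'] E; rewrite -pj -pj'; apply: pi_eq => //; apply/ww'.
Qed.
End Cofinality.

(** * Indiscernible sets *)

Lemma finite_set_enum (T : Type) (x0 : T) (A : set T) : finite_set A ->
  exists N (g : nat -> T), forall x, A x -> exists2 i, i < N & g i = x.
Proof.
move=> [N /card_eqPle[AN _]]; have [->|/set0P A0] := eqVneq A set0.
  by exists 0, (fun=> x0).
have [g _ gs] := surj_of_card_le AN A0.
by exists N, g => x /gs[i iN gi]; exists i.
Qed.

Lemma card_setU1_image_lt (T U V : Type) (f : T -> U) (A : set T) (u : U)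
    (C : set V) : infinite_set C -> ~ (C #<= A) -> ~ (C #<= f @` A `|` [set u]).
Proof.
move=> Cinf CA CB; have [Afin|Ainf] := pselect (finite_set A).
  apply: Cinf; apply: card_le_finite CB _; rewrite finite_setU.
  by split; [exact: finite_image|exact: finite_set1].
apply: CA; apply: card_le_trans CB _.
apply: (card_setU_le Ainf (card_infiniteX Ainf) (card_image_le _ _)).
by apply: card_le_trans ((infiniteP _).1 Ainf); apply: countable1.
Qed.

Section Shapes.
Variables (L : language) (M : structure L) (m0 : M).

(* [t] says which coordinate of which variable of the valuation [v] is
   substituted for each variable of [phi]. *)
Definition shape_rel m d (phi : formula L) (t : {ffun 'I_m -> 'I_m * 'I_d.+1})
    (v : nat -> nat -> M) : Prop :=
  sat (fun x => if insub x is Some o then v (t o).1 (t o).2 else m0) phi.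

(** A partition of the substituted tuples induces one of the variables of [phi], so half graphs
    carry over to [phi] with the same length. *)
Lemma stable_shape_rel (T : set (formula L)) m d phi t :
  stable T -> models M T -> stable_rel (@shape_rel m d phi t).
Proof.
move=> stT MT p; pose sub (v : nat -> nat -> M) (x : nat) :=
  if insub x is Some o then v (t o).1 (t o).2 else m0.
have [N HN] := stable_sat phi stT MT
  (fun x => if insub x is Some o then p (t o).1 else true).
exists N => a b hg; apply: (HN (sub \o a) (sub \o b)) => i j iN jN.
rewrite -(hg i j iN jN) /shape_rel.
suff -> : (fun x => if insub x is Some o then mix p (a i) (b j) (t o).1 (t o).2
    else m0) = mix (fun x => if insub x is Some o then p (t o).1 else true)
      ((sub \o a) i) ((sub \o b) j) by [].
apply/funext => x; rewrite /mix /sub /=; case: insubP => [o _ _|_] //.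
by case: ifP.
Qed.

Lemma supported_shape_rel m d phi t : supported m (@shape_rel m d phi t).
Proof.
move=> u u' uu'; congr (sat _ phi); apply/funext => x.
by case: insubP => // o _ _; rewrite uu'.
Qed.

End Shapes.

Theorem theorem2p6
  (L : language) (L_countable : countable_language L)
  (T : set (formula L)) (T_complete : complete_theory T) (T_stable : stable T)
  (Delta : set (formula L)) (Delta_finite : finite_set Delta)
  (K : Type) (le : rel K) (K_singular : singular_cardinal le)
  (d : nat)
  (M : structure L) (M_models : models M T)
  (A : set M) (A_small : lt_cof A le)
  (X : set (d.-tuple M)) (X_large : [set: K] #<= X) :
  exists (Y : set (d.-tuple M)) (E : d.-tuple M -> d.-tuple M -> Prop),
    [/\ Y `<=` X,
        Y #= [set: K],
        equivalence_on Y E,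
        infinite_set (eclasses Y E)
      & (forall C, eclasses Y E C -> infinite_set C) /\
        indiscernible Delta Y E A].
Proof.
have [cardK Kinf [C cofC [_ KC]]] := K_singular.
have [_ CA] := A_small _ cofC.
have [m0] := dom_inhabited M.
have [N [g gDelta]] := finite_set_enum (@Bot L) Delta_finite.
have [bd bdP] := choice (fun i => fv_bound (g i)).
pose m := \max_(i < N) bd i.
have gm i x : i < N -> fv (g i) x -> x < m.
  move=> iN /bdP xb; apply: leq_trans xb _.
  exact: (leq_bigmax (Ordinal iN) (F := fun i : 'I_N => bd i)).
(* Tuples and parameters are put in the common type [nat -> M]: tuples are padded with [m0],
   parameters become constant functions. *)
pose d0 : nat -> M := fun=> m0.
pose B : set (nat -> M) := (fun a => fun=> a) @` A `|` [set d0].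
pose emb (t : d.-tuple M) : nat -> M := nth m0 t.
have embI t t' : emb t = emb t' -> t = t'.
  move=> E; apply: eq_from_tnth => i.
  by rewrite !(tnth_nth m0); apply: (congr1 (@^~ (val i)) E).
(* An index records an enumerated formula, the coordinate substituted for each variable, and the set
   of variables filled by elements of the sequence. *)
pose I : finType := ('I_N * {ffun 'I_m -> 'I_m * 'I_d.+1} * {set 'I_m})%type.
pose R (i : I) := shape_rel m0 (g i.1.1) i.1.2.
pose Lv (i : I) : seq nat := [seq val o | o <- enum i.2].
have [|||||||W [y [WX yI KW [Winf Wcls] ind]]] :=
  @uniform_sequence K le cardK Kinf C cofC KC _ d0 B (emb @` X) I R Lv m.
- by right.
- by apply: card_setU1_image_lt => //; apply: (cof_infinite cardK Kinf cofC).
- apply: card_le_trans X_large _.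
  by apply: (@card_le_of_inj _ _ _ _ emb) => [t Xt|t t' _ _ /embI//]; exists t.
- by move=> i; apply: stable_shape_rel.
- by move=> i; apply: supported_shape_rel.
- by move=> i; rewrite map_inj_uniq ?enum_uniq //; apply: val_inj.
- by move=> i; apply/allP => _ /mapP[o _ ->]; apply: ltn_ord.
have : forall w, exists t, W w -> X t /\ emb t = y w.
  move=> w; have [/WX[t Xt ty]|] := pselect (W w); first by exists t.
  by exists (nseq_tuple d m0).
move=> /choice[tau tauP].
have tauX w : W w -> X (tau w) by case/tauP.
have tauE w : W w -> emb (tau w) = y w by case/tauP.
have tauI w w' : W w -> W w' -> tau w = tau w' -> w = w'.
  by move=> Ww Ww' E; apply: yI => //; rewrite -!tauE // E.
pose E t t' := exists w w',
  [/\ W w, W w', tau w = t, tau w' = t' & w.1 = w'.1].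
have EP w w' : W w -> W w' -> E (tau w) (tau w') <-> w.1 = w'.1.
  move=> Ww Ww'; split=> [[v [v' [Wv Wv' vw vw' vv']]]|]; last by exists w, w'.
  by rewrite -(tauI _ _ Wv Ww vw) -(tauI _ _ Wv' Ww' vw').
pose cls c := tau @` [set w | W w /\ w.1 = c].
have clsE w : W w -> eclass (tau @` W) E (tau w) = cls w.1.
  move=> Ww; apply/seteqP; split=> [_ [[w' Ww' <-] /EP e]|_ [w' [Ww' w'w] <-]].
    by exists w' => //; split=> //; rewrite e.
  by split; [exists w'|apply/EP].
exists (tau @` W), E; split.
- by move=> _ [w Ww <-]; apply: tauX.
(* [W] consists of pairs from [K], so Hessenberg's theorem bounds the size of its image. *)
- apply/card_eqPle; split.
    apply: card_le_trans (card_image_le _ _) _.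
    apply: card_le_trans (card_leT _) _; rewrite -setXTT.
    exact: card_infiniteX.
  apply: card_le_trans KW _.
  by apply: (@card_le_of_inj _ _ _ _ tau) => // w Ww; exists w.
- split.
  + by move=> _ [w Ww <-]; apply/EP.
  + by move=> _ _ [w Ww <-] [w' Ww' <-] /EP e; apply/EP => //; rewrite e.
  + move=> _ _ _ [w Ww <-] [w' Ww' <-] [w2 Ww2 <-] /EP e /EP e'; apply/EP => //.
    by rewrite e // e'.
- move=> fin; apply: Winf; apply: card_le_finite fin.
  apply: (@card_le_of_inj _ _ _ _ cls) => [_ [w Ww <-]|].
    by exists (tau w); [exists w|rewrite clsE].
  move=> _ c' [w Ww <-] _ ecls; have : cls c' (tau w) by rewrite -ecls; exists w.
  by move=> [w' [Ww' <-] /tauI ->].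
split.
  move=> _ [_ [w Ww <-] <-]; rewrite clsE // => fin.
  apply: (Wcls w Ww); apply: card_le_finite fin.
  apply: (@card_le_of_inj _ _ _ _ tau) => [w' Ww'|w' w2 [Ww' _] [Ww2 _]].
    by exists w'.
  exact: tauI.
move=> n a b Ya Yb ainj binj Eab.
suff satE q : Delta q.1 -> (forall x c, fv q.1 x -> q.2 x = inr c -> A c) ->
    sat (fun x => match q.2 x with inl i => concat a i | inr c => c end) q.1 <->
    sat (fun x => match q.2 x with inl i => concat b i | inr c => c end) q.1.
  by apply/seteqP; split=> q [Dq Aq sq]; split=> //; apply/satE.
case: q => phi s /= /gDelta[i0 i0N <-] As.
have Wof (e : 'I_n -> d.-tuple M) : (forall i, (tau @` W) (e i)) ->
    exists w : 'I_n -> K * K, forall i, W (w i) /\ tau (w i) = e i.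
  move=> Ye; suff /choice[w wP] : forall i, exists w, W w /\ tau w = e i by exists w.
  by move=> i; have [w Ww we] := Ye i; exists w.
have [wa waP] := Wof a Ya; have [wb wbP] := Wof b Yb.
have [k0 _] := infinite_setN0 Kinf.
(* Several variables may refer to the same tuple, whereas [ind] needs distinct elements at distinct
   variables. [idx x] is the tuple named by [x], if any, and [rep x] is the first variable with the
   same [idx]. *)
pose idx (x : nat) : option 'I_n :=
  if `[< fv (g i0) x >] then if s x is inl k then Some k.1 else None else None.
pose rep x := index (idx x) [seq idx z | z <- iota 0 m].
have idx_rep x : x < m -> rep x < m /\ idx (rep x) = idx x.
  move=> xm; have xin : idx x \in [seq idx z | z <- iota 0 m].
    by apply: map_f; rewrite mem_iota.
  have rm : rep x < m by move: (xin); rewrite -index_mem size_map size_iota.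
  split=> //; have := nth_index None xin; rewrite -/(rep x).
  by rewrite (nth_map 0) ?size_iota // nth_iota // add0n.
have rep_eq x x' : idx x = idx x' -> rep x = rep x' by rewrite /rep => ->.
(* ['I_d.+1] is inhabited even for [d = 0], which provides the default [ord0]. *)
pose co x : 'I_d.+1 := if s x is inl k then inord k.2 else ord0.
pose t : {ffun 'I_m -> 'I_m * 'I_d.+1} := [ffun o : 'I_m =>
  if idx o is Some _ then (insubd o (rep o), co o) else (o, ord0)].
pose S : {set 'I_m} := finset (fun o : 'I_m => isSome (idx o) && (rep o == o)).
pose p j : nat -> M :=
  if `[< fv (g i0) j >] then if s j is inr c then fun=> c else d0 else d0.
pose i : I := (Ordinal i0N, t, S).
have LvP j : j \in Lv i -> [/\ j < m, exists k, idx j = Some k & rep j = j].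
  move=> /mapP[o]; rewrite mem_enum inE => /andP[io /eqP ro] ->.
  by split; [exact: ltn_ord|case: (idx o) io => // k _; exists k|].
(* The index [i] and the parameters [p] depend on [s] but not on the tuples, so both sequences are
   tested by the same relation. *)
have shapeP (e : 'I_n -> d.-tuple M) (w : 'I_n -> K * K) :
    (forall i, W (w i) /\ tau (w i) = e i) ->
    sat (fun x => match s x with inl k => concat e k | inr c => c end) (g i0) =
    R i (fun j => if j \in Lv i then y (if idx j is Some k then w k else (k0, k0))
                  else p j).
  move=> wP; apply: sat_ext => x fx; have xm := gm _ _ i0N fx.
  rewrite insubT /= ffunE /=.
  case sx : (s x) => [[k l]|c].
    have ix : idx x = Some k by rewrite /idx asboolT // sx.
    have [rm ir] := idx_rep x xm.
    have rL : rep x \in Lv i.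
      apply/mapP; exists (Ordinal rm) => //; rewrite mem_enum inE /= ir ix /=.
      by apply/eqP; apply: rep_eq; rewrite ir.
    rewrite ix /= val_insubd rm rL ir ix /co sx /= inordK ?(ltnW (ltn_ord l)) //.
    have [Ww we] := wP k; rewrite -tauE // we /concat /= (tnth_nth m0) //.
    by rewrite ltnS ltnW.
  have ix : idx x = None by rewrite /idx asboolT // sx.
  rewrite ix /=; case: ifP => [/LvP[_ [k]]|_]; first by rewrite ix.
  by rewrite /p asboolT // sx.
rewrite (shapeP a wa waP) (shapeP b wb wbP).
have wE (e : 'I_n -> d.-tuple M) (w : 'I_n -> K * K) : injective e ->
    (forall i, W (w i) /\ tau (w i) = e i) ->
    forall j j', j \in Lv i -> j' \in Lv i ->
    (if idx j is Some k then w k else (k0, k0)) =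
    (if idx j' is Some k then w k else (k0, k0)) -> j = j'.
  move=> einj wP j j' /LvP[_ [k jk] rj] /LvP[_ [k' jk'] rj'].
  rewrite jk jk' => ww; rewrite -rj -rj'; apply: rep_eq; rewrite jk jk'.
  by congr Some; apply: einj; rewrite -(wP k).2 -(wP k').2 ww.
apply: ind.
- by move=> j /LvP[_ [k ->] _]; split; [exact: (waP k).1|exact: (wbP k).1].
- exact: wE ainj waP.
- exact: wE binj wbP.
- move=> j j' /LvP[_ [k ->] _] /LvP[_ [k' ->] _].
  have [Wak ak] := waP k; have [Wak' ak'] := waP k'.
  have [Wbk bk] := wbP k; have [Wbk' bk'] := wbP k'.
  apply: (iff_trans (iff_sym (EP _ _ Wak Wak'))).
  apply: (iff_trans _ (EP _ _ Wbk Wbk')); rewrite ak ak' bk bk'.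
  have Esym u v : E u v -> E v u by move=> [v1 [v2 [? ? ? ? ?]]]; exists v2, v1.
  (* [Eab] covers only increasing pairs; symmetry and reflexivity of [E] give the rest. *)
  have [lkk|lkk|/val_inj->] := ltngtP k k'; first exact: Eab.
    by split=> /Esym h; apply: Esym; apply/Eab.
  by split=> _; [rewrite -bk'|rewrite -ak']; apply/EP.
- move=> j; rewrite /p; case: asboolP => fj; last by right.
  case sj : (s j) => [k|c]; first by right.
  by left; exists c => //; apply: As fj sj.
Qed.
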